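(* Let $X_1,X_2,\ldots$ be i.i.d. from $g$, and consider the problems $(\mathcal P_n)$ and $(\mathcal D_n)$ defined in the context. (a) (Weak duality) For any sample size $n$ and any realization of $X_1,\ldots,X_n$, $val(\mathcal P_n)\le val(\mathcal D_n)$. (b) (Strong duality) Suppose that (i) for every $L\in\mathcal L$ the random variables $\phi_j(X)L(X)$, $j=0,\ldots,l$, are integrable with respect to $g$; (ii) $\mathcal L$ is a convex set; (iii) there exists $L_0\in\mathcal L$ such that $\mathbb E_g[\phi_j(X)L_0(X)]<\mu_j$ for $j=1,\ldots,m$ and $\mathbb E_g[\phi_j(X)L_0(X)]=\mu_j$ for $j=m+1,\ldots,l$, and moreover $(\mu_{m+1},\ldots,\mu_l)$ is an interior point of $\{(\mathbb E_g[\phi_{m+1}(X)L(X)],\ldots,\mathbb E_g[\phi_l(X)L(X)]):L\in\mathcal L\}\subset\mathbb R^{l-m}$. Then $$\mathbb P_*\Big(\bigcup_{n=1}^\infty\bigcap_{k=n}^\infty\{val(\mathcal P_k)=val(\mathcal D_k)\}\Big)=\mathbb P_*\big(\exists N_0\in\mathbb N\text{ s.t. }val(\mathcal P_n)=val(\mathcal D_n)\ \forall n\ge N_0\big)=1,$$ and, as $n\to\infty$, $\mathbb P_*(val(\mathcal P_n)=val(\mathcal D_n))\to1$.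
   Context: Setting. $\mathcal X$ is a subset of a Euclidean space, $\phi_0,\ldots,\phi_l:\mathcal X\to\mathbb R$ are known functions, $0\le m\le l$, and $\mu_1,\ldots,\mu_l\in\mathbb R$. One of $\phi_1,\ldots,\phi_l$ is the indicator $I(x\in\mathcal X)$ (total mass constraint). $\mathcal F$ is a class of nonnegative functions (densities whose total mass is prescribed only through the moment constraints) on $\mathcal X$. $g$ is a fixed positive probability density on $\mathcal X$, $X$ has density $g$, $\mathbb E_g$ is expectation under $g$, and $\mathcal L=\{f/g:f\in\mathcal F\}$. Problem $(\mathcal P_n)$: $$\sup_{L\in\mathcal L}\ \frac1n\sum_{i=1}^n\phi_0(X_i)L(X_i)\quad\text{subject to}\quad \frac1n\sum_{i=1}^n\phi_j(X_i)L(X_i)\le\mu_j,\ j\le m,\qquad \frac1n\sum_{i=1}^n\phi_j(X_i)L(X_i)=\mu_j,\ m<j\le l.$$ Lagrangian dual $(\mathcal D_n)$: $$\inf_{\lambda\in\mathbb R_+^m\times\mathbb R^{l-m}}\ \sup_{L\in\mathcal L}\frac1n\sum_{i=1}^n\Big(\phi_0(X_i)L(X_i)-\sum_{j=1}^l\lambda_j(\phi_j(X_i)L(X_i)-\mu_j)\Big).$$ $val(\cdot)$ denotes the optimal value in $[-\infty,\infty]$ (with $\sup\emptyset=-\infty$). If $l=m$, the interior point condition is vacuous. On the underlying probability space $(\Omega,\mathcal G,\mathbb P)$, the inner probability of an arbitrary $B\subset\Omega$ is $\mathbb P_*(B)=\sup\{\mathbb P(A):A\subset B,\ A\in\mathcal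 G\}$. *)

(* Defs.v *)
From HB Require Import structures.
From mathcomp Require Import all_boot all_order all_algebra.
From mathcomp Require Import all_classical all_reals all_analysis.

Set Implicit Arguments.
Unset Strict Implicit.
Unset Printing Implicit Defensive.

Import Order.TTheory GRing.Theory Num.Theory numFieldNormedType.Exports.

Local Open Scope classical_set_scope.
Local Open Scope ring_scope.

(* The product sigma-algebra on tuples is the Borel sigma-algebra of R^d. *)
Notation euclid R d := (d.-tuple (measurableTypeR R)).

Section lebesgue_euclid.
Context {R : realType}.
Local Open Scope ereal_scope.

Definition econs (d : nat) (p : measurableTypeR R * euclid R d) :
  euclid R d.+1 := [tuple of p.1 :: p.2].

(* d-dimensional Lebesgue measure, as an iterated product. *)
Fixpoint lebesgue_euclid (d : nat) : set (euclid R d) -> \bar R :=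
  if d is d'.+1 then
    pushforward (@lebesgue_measure R \x @lebesgue_euclid d') (@econs d')
  else \d_([tuple] : euclid R 0).

Lemma measurable_econs d : measurable_fun [set: _] (@econs d).
Proof. exact: measurable_cons. Qed.

Section step.
Variables (d : nat) (m : {sigma_finite_measure set (euclid R d) -> \bar R}).

Let prodm : {measure set (measurableTypeR R * euclid R d)%type -> \bar R} :=
  (@lebesgue_measure R \x m).

Let pushm := pushforward prodm (@econs d).

Let pushm0 : pushm set0 = 0.
Proof. by rewrite /pushm /pushforward preimage_set0 (measure0 prodm). Qed.

Let pushm_ge0 A : 0 <= pushm A.
Proof. exact: (measure_ge0 prodm). Qed.

Let pushm_sigma_additive : semi_sigma_additive pushm.
Proof.
have mpre A : measurable A -> measurable (@econs d @^-1` A).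
  by move=> mA; rewrite -[X in measurable X]setTI; exact: measurable_econs.
move=> F mF tF mUF; rewrite /pushm /pushforward preimage_bigcup.
apply: (@measure_semi_sigma_additive _ _ _ prodm).
- by move=> n; exact: mpre.
- apply/trivIsetP => /= i j _ _ ij; rewrite -preimage_setI.
  by move/trivIsetP : tF => /(_ _ _ _ _ ij) ->//; rewrite preimage_set0.
- by rewrite -preimage_bigcup; exact: mpre.
Qed.

HB.instance Definition _ := isMeasure.Build _ _ _ pushm
  pushm0 pushm_ge0 pushm_sigma_additive.

Let pushm_sigma_finite : sigma_finite setT pushm.
Proof.
pose h (t : euclid R d.+1) := (thead t, [tuple of behead t]).
have mh : measurable_fun setT h.
  apply/measurable_fun_pair => /=.
    exact: (measurable_tnth (ord0 : 'I_d.+1)).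
  exact: measurable_behead.
have hK p : h (econs p) = p.
  by case: p => a t; rewrite /h /econs theadE; congr (_, _); exact/val_inj.
have /sigma_finiteP[F [TF ndF Foo]] := sigma_finiteT (@lebesgue_measure R).
have /sigma_finiteP[G [TG ndG Goo]] := sigma_finiteT m.
exists (fun k => h @^-1` (F k `*` G k)).
  rewrite -preimage_bigcup; apply/seteqP; split => // t _.
  have [k _ Fk] : (\bigcup_k F k) (h t).1 by rewrite -TF.
  have [k' _ Gk'] : (\bigcup_k G k) (h t).2 by rewrite -TG.
  exists (maxn k k') => //; split.
    by move: Fk; exact/subsetPset/ndF/leq_maxl.
  by move: Gk'; exact/subsetPset/ndG/leq_maxr.
move=> k; have [mF Fk] := Foo k; have [mG Gk] := Goo k; split.
  by rewrite -[X in measurable X]setTI; apply: mh => //; exact: measurableX.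
have -> : pushm (h @^-1` (F k `*` G k)) = prodm (F k `*` G k).
  by congr (prodm _); apply/seteqP; split => p; rewrite /preimage /mkset hK.
by rewrite /prodm /= product_measure1E// lte_mul_pinfty// ge0_fin_numE.
Qed.

HB.instance Definition _ :=
  Measure_isSigmaFinite.Build _ _ _ pushm pushm_sigma_finite.

Lemma lebesgue_euclid_step :
  {m' : {sigma_finite_measure set (euclid R d.+1) -> \bar R} |
    m' = pushforward (@lebesgue_measure R \x m) (@econs d) :> (set _ -> _)}.
Proof. by exists pushm. Qed.

End step.

Lemma lebesgue_euclid_is_sigma_finite_measure d :
  {m : {sigma_finite_measure set (euclid R d) -> \bar R} |
     m = lebesgue_euclid (d:=d) :> (set _ -> \bar R)}.
Proof.
elim: d => [|d [m mE]].
  by exists (\d_([tuple] : euclid R 0)).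
by have [m' m'E] := lebesgue_euclid_step m; exists m'; rewrite m'E /= -mE.
Qed.

Let lebesgue_euclid0 d : lebesgue_euclid (set0 : set (euclid R d)) = 0.
Proof.
have [m <-] := lebesgue_euclid_is_sigma_finite_measure d; exact: measure0.
Qed.

Let lebesgue_euclid_ge0 d (A : set (euclid R d)) : 0 <= lebesgue_euclid A.
Proof.
have [m <-] := lebesgue_euclid_is_sigma_finite_measure d; exact: measure_ge0.
Qed.

Let lebesgue_euclid_sigma_additive d :
  semi_sigma_additive (@lebesgue_euclid d).
Proof.
have [m <-] := lebesgue_euclid_is_sigma_finite_measure d.
exact: measure_semi_sigma_additive.
Qed.

HB.instance Definition _ d := isMeasure.Build _ _ _ (@lebesgue_euclid d)
  (@lebesgue_euclid0 d) (@lebesgue_euclid_ge0 d)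
  (@lebesgue_euclid_sigma_additive d).

Let lebesgue_euclid_sigma_finite d :
  sigma_finite setT (@lebesgue_euclid d).
Proof.
have [m <-] := lebesgue_euclid_is_sigma_finite_measure d; exact: sigma_finiteT.
Qed.

HB.instance Definition _ d := Measure_isSigmaFinite.Build _ _ _
  (@lebesgue_euclid d) (@lebesgue_euclid_sigma_finite d).

Lemma lebesgue_euclid_box d (A : 'I_d -> set (measurableTypeR R)) :
  (forall i, measurable (A i)) ->
  lebesgue_euclid [set t : euclid R d | forall i, A i (tnth t i)] =
  \prod_(i < d) lebesgue_measure (A i).
Proof.
elim: d A => [|d IH] A mA /=.
  rewrite big_ord0 diracE mem_set// => i; by case: i.
pose B := [set t : euclid R d | forall i, A (lift ord0 i) (tnth t i)].
have mB : measurable B.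
  rewrite (_ : B = \bigcap_(i in [set: 'I_d])
      ((fun t => tnth t i) @^-1` A (lift ord0 i))); last first.
    by apply/seteqP; split => t /= Bt i; [move=> _; exact: Bt|exact: (Bt i)].
  apply: fin_bigcap_measurable => [|i _]; first exact: finite_finset.
  by rewrite -[X in measurable X]setTI; exact: measurable_tnth.
rewrite big_ord_recl -IH//.
rewrite /pushforward (_ : _ @^-1` _ = A ord0 `*` B).
  by rewrite product_measure1E.
apply/seteqP; split => -[x t] /=.
  move=> h; split; first exact: (h ord0).
  by move=> i; have := h (lift ord0 i); rewrite /econs tnthS.
move=> [Ax Bt] i; case: (unliftP ord0 i) => [j|] ->; last by [].
by rewrite /econs tnthS; exact: Bt.
Qed.

End lebesgue_euclid.

Section densities.
Context {R : realType} {d : nat} (D : set (euclid R d)).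
Implicit Types g h : D -> R.

(* A function on D is integrated over D through its extension by 0 to R^d. *)
Definition is_pos_density g : Prop :=
  [/\ measurable_fun D ('valL_0 g),
      forall x, 0 < g x
    & (\int[@lebesgue_euclid R d]_(x in D) ('valL_0 g x)%:E = 1)%E].

Definition density_integrable g h : Prop :=
  (@lebesgue_euclid R d).-integrable D
    (fun x => ('valL_0 (fun y => h y * g y) x)%:E).

Definition density_expectation g h : R :=
  \int[@lebesgue_euclid R d]_(x in D) 'valL_0 (fun y => h y * g y) x.

Definition likelihood_ratios (F : set (D -> R)) g : set (D -> R) :=
  [set (fun x => f x / g x) | f in F].

Context {dO : measure_display} {Omega : measurableType dO}.
Variables (P : probability Omega R) (X : nat -> Omega -> D).

Definition has_density (Y : Omega -> D) g : Prop :=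
  forall B : set (euclid R d), measurable B ->
    P [set w | B (val (Y w))] =
    (\int[@lebesgue_euclid R d]_(x in B `&` D) ('valL_0 g x)%:E)%E.

Definition mutually_independent : Prop :=
  forall (s : seq nat) (B : nat -> set (euclid R d)), uniq s ->
    (forall i, measurable (B i)) ->
    (P (\bigcap_(i in [set` s]) [set w | B i (val (X i w))]) =
     \prod_(i <- s) P [set w | B i (val (X i w))])%E.

Definition iid_from g : Prop :=
  [/\ forall i, measurable_fun [set: Omega] (fun w => val (X i w)),
      forall i, has_density (X i) g
    & mutually_independent].

End densities.

Definition inner_probability {R : realType} {dO : measure_display}
    {Omega : measurableType dO} (P : probability Omega R)
    (B : set Omega) : \bar R :=
  ereal_sup [set P A | A in [set A | measurable A /\ A `<=` B]].

(* The constraint functions are phi 1, ..., phi l, with levels mu 1, ..., mu l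
   and multipliers lambda 1, ..., lambda l; the objective is phi 0. All other
   values of these sequences are irrelevant. The sample of size n is
   x 0, ..., x n.-1. *)
Section sample_problems.
Context {R : realType} {T : Type}.
Variables (m l : nat) (phi : nat -> T -> R) (mu : nat -> R).
Variable (LL : set (T -> R)).
Variables (n : nat) (x : nat -> T).

Definition sample_mean (h : T -> R) : R := n%:R^-1 * \sum_(i < n) h (x i).

Definition sample_feasible (L : T -> R) : Prop :=
  [/\ LL L,
      forall j, (1 <= j <= m)%N ->
        sample_mean (fun y => phi j y * L y) <= mu j
    & forall j, (m < j <= l)%N ->
        sample_mean (fun y => phi j y * L y) = mu j].

Definition primal_val : \bar R :=
  ereal_sup [set (sample_mean (fun y => phi 0%N y * L y))%:E
            | L in sample_feasible].

Definition sample_lagrangian (lambda : nat -> R) (L : T -> R) : R :=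
  sample_mean (fun y =>
    phi 0%N y * L y - \sum_(1 <= j < l.+1) lambda j * (phi j y * L y - mu j)).

Definition dual_val : \bar R :=
  ereal_inf [set ereal_sup [set (sample_lagrangian lambda L)%:E | L in LL]
            | lambda in [set lambda : nat -> R |
                forall j, (1 <= j <= m)%N -> 0 <= lambda j]].

End sample_problems.

(* Main.v *)
Require Import Defs.
From mathcomp Require Import all_boot all_order all_algebra.
From mathcomp Require Import all_classical all_reals all_analysis.
From mathcomp Require Import measurable_realfun.
From mathcomp Require Import ring lra.
Import Order.TTheory GRing.Theory Num.Theory numFieldNormedType.Exports.
Local Open Scope classical_set_scope.
Local Open Scope ring_scope.
Set Implicit Arguments.
Unset Strict Implicit.
Unset Printing Implicit Defensive.

(* Mixing L_0 with likelihood ratios whose expectations are mu +- delta e_i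
   (they exist by the interior point condition) yields finitely many witnesses in L:
   all satisfy the inequality constraints strictly in expectation, and for each
   equality constraint i and each sign one of them violates only the i-th
   constraint, in that direction. By the strong law of large numbers, almost
   surely the sample means of these witnesses are eventually so close to the
   expectations that no nonzero multiplier with lambda_j >= 0 for j <= m makes
   sum_j lambda_j (mean(phi_j L) - mu_j) nonnegative on all of L. For such a
   sample, separating the origin from the convex set of attainable objective and
   constraint values gives a functional whose objective coefficient cannot
   vanish, that is, an optimal dual multiplier. *)

(** * Lagrange duality *)

Section lagrange_duality.
Context {R : realType}.

(** Induction on the dimension: slice [C] by the hyperplane where the last coordinate vanishes, then
    extend the functional found on the slice by one coefficient, as in the Hahn-Banach theorem. The
    argument is algebraic, so [C] may fail to be closed. *)
Lemma convex_separation_origin (N : nat) (C : set (nat -> R)) :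
  C !=set0 ->
  (forall c c' t, C c -> C c' -> 0 < t < 1 ->
    C (fun j => t * c j + (1 - t) * c' j)) ->
  (exists2 c, C c & forall j, (j < N)%N -> c j = 0) \/
  exists lambda : nat -> R, (exists2 j, (j < N)%N & lambda j != 0) /\
    forall c, C c -> 0 <= \sum_(j < N) lambda j * c j.
Proof.
elim: N C => [|N IH] C [c0 Cc0] Ccvx; first by left; exists c0.
have [Cge0|/existsNP[c1 /not_implyP[Cc1 /negP]]] :=
    pselect (forall c, C c -> 0 <= c N).
  right; exists (fun j => (j == N)%:R); split.
    by exists N => //; rewrite eqxx oner_neq0.
  move=> c Cc; rewrite big_ord_recr/= eqxx mul1r big1 ?add0r; first exact: Cge0.
  by move=> j _; rewrite ltn_eqF// mul0r.
rewrite -ltNge => c1N.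
have [Cle0|/existsNP[c2 /not_implyP[Cc2 /negP]]] :=
    pselect (forall c, C c -> c N <= 0).
  right; exists (fun j => - (j == N)%:R); split.
    by exists N => //; rewrite eqxx oppr_eq0 oner_neq0.
  move=> c Cc; rewrite big_ord_recr/= eqxx mulN1r big1 ?add0r ?oppr_ge0.
    exact: Cle0.
  by move=> j _; rewrite ltn_eqF// oppr0 mul0r.
rewrite -ltNge => c2N.
(* the point where the segment [c, c'] crosses the hyperplane {c N = 0} *)
have cross c c' : C c -> C c' -> c N < 0 -> 0 < c' N ->
    let t := c' N / (c' N - c N) in
    [/\ 0 < t < 1, t * c N + (1 - t) * c' N = 0
      & C (fun j => t * c j + (1 - t) * c' j)].
  move=> Cc Cc' cN c'N t.
  have d0 : 0 < c' N - c N by lra.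
  have t01 : 0 < t < 1.
    by rewrite /t divr_gt0//= ltr_pdivrMr// mul1r ltrDl oppr_gt0.
  split=> //; last exact: Ccvx.
  by rewrite /t; field; rewrite gt_eqF.
pose C' := [set c | C c /\ c N = 0].
have C'0 : C' !=set0.
  by have [_ ? ?] := cross c1 c2 Cc1 Cc2 c1N c2N; eexists; split; eassumption.
have C'cvx c c' t : C' c -> C' c' -> 0 < t < 1 ->
    C' (fun j => t * c j + (1 - t) * c' j).
  move=> [Cc cN] [Cc' c'N] t01; split; first exact: Ccvx.
  by rewrite cN c'N !mulr0 addr0.
have [[c [Cc cN] c0']|[lambda [[j jN lj] lge0]]] := IH C' C'0 C'cvx.
  left; exists c => // j; rewrite ltnS leq_eqVlt => /predU1P[->//|].
  exact: c0'.
pose f c := \sum_(j < N) lambda j * c j.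
have fcvx t c c' : f (fun j => t * c j + (1 - t) * c' j) =
    t * f c + (1 - t) * f c'.
  rewrite /f !mulr_sumr -big_split/=; apply: eq_bigr => i _; ring.
(* Nonnegativity at the crossing point makes the bounds on the last coefficient from the two sides
   of the hyperplane compatible. *)
have slopes c c' : C c -> C c' -> c N < 0 -> 0 < c' N ->
    - f c' / c' N <= f c / - c N.
  move=> Cc Cc' cN c'N; have [/andP[t0 t1] tN Ct] := cross c c' Cc Cc' cN c'N.
  have := lge0 _ (conj Ct tN); rewrite -/(f _) fcvx.
  have d0 : 0 < c' N - c N by lra.
  rewrite (_ : _ + _ = (c' N * f c - c N * f c') / (c' N - c N)); last first.
    by field; rewrite gt_eqF.
  rewrite pmulr_lge0 ?invr_gt0// => h.
  rewrite ler_pdivrMr// mulrAC ler_pdivlMr ?oppr_gt0//; lra.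
(* Each point with positive last coordinate bounds the new coefficient from below; the supremum is
   the least admissible choice. *)
pose S := [set - f c / c N | c in [set c | C c /\ 0 < c N]].
have Ssup : has_sup S.
  split; first by exists (- f c2 / c2 N), c2.
  by exists (f c1 / - c1 N) => _ [c [Cc cN] <-]; exact: slopes.
right; exists (fun j => if j == N then sup S else lambda j); split.
  by exists j; [exact: ltnW|rewrite ltn_eqF].
move=> c Cc; rewrite big_ord_recr/= eqxx.
rewrite (eq_bigr (fun j : 'I_N => lambda j * c j)); last first.
  by move=> i _; rewrite ltn_eqF.
rewrite -/(f c); have [cN|cN|cN] := ltgtP (c N) 0.
- have : sup S <= f c / - c N.
    by apply: ge_sup; [exact: Ssup.1|move=> _ [c' [? ?] <-]; exact: slopes].
  rewrite ler_pdivlMr ?oppr_gt0//; lra.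
- have : - f c / c N <= sup S.
    by apply: ub_le_sup; [exact: Ssup.2|exists c].
  rewrite ler_pdivrMr//; lra.
- by rewrite cN mulr0 addr0; exact: lge0.
Qed.

(* [h 0] is the objective; the constraints are [h j <= 0] for [1 <= j <= m] and
   [h j = 0] for [m < j <= l]. Applied to a nonzero separating functional,
   [nondeg] says that the multiplier of the objective does not vanish; it plays
   the role of Slater's condition. *)
Lemma lagrange_multiplier (T : Type) (LL : set T) (m l : nat)
    (h : nat -> T -> R) (p : R) :
  (m <= l)%N -> LL !=set0 ->
  (forall L L' t, LL L -> LL L' -> 0 < t < 1 -> exists2 L'', LL L'' &
    forall j, (j <= l)%N -> h j L'' = t * h j L + (1 - t) * h j L') ->
  (forall lambda : nat -> R, (forall j, (1 <= j <= m)%N -> 0 <= lambda j) ->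
    (exists2 j, (1 <= j <= l)%N & lambda j != 0) ->
    exists2 L, LL L & \sum_(1 <= j < l.+1) lambda j * h j L < 0) ->
  (forall L, LL L -> (forall j, (1 <= j <= m)%N -> h j L <= 0) ->
    (forall j, (m < j <= l)%N -> h j L = 0) -> h 0%N L <= p) ->
  exists2 lambda : nat -> R, forall j, (1 <= j <= m)%N -> 0 <= lambda j &
    forall L, LL L ->
      h 0%N L - \sum_(1 <= j < l.+1) lambda j * h j L <= p.
Proof.
move=> ml [L0 LL0] cvx nondeg hp.
(* The attainable values are enlarged upwards in the coordinates up to [m]. The strict inequality in
   coordinate [0] keeps the origin out: a point there would be feasible with objective above [p]. *)
pose C := [set c : nat -> R | exists2 L, LL L & [/\ p - h 0%N L < c 0%N,
  forall j, (1 <= j <= m)%N -> h j L <= c j &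
  forall j, (m < j <= l)%N -> h j L = c j]].
have Cmem L s : LL L -> 0 < s ->
    C (fun j => if j == 0%N then p - h 0%N L + s else h j L).
  move=> LLL s0; exists L => //; split=> //=; first by lra.
    by move=> [].
  by move=> [|j] //; rewrite ltn0.
have Ccvx c c' t : C c -> C c' -> 0 < t < 1 ->
    C (fun j => t * c j + (1 - t) * c' j).
  move=> [L LLL [c0 cle ceq]] [L' LLL' [c'0 c'le c'eq]] /[dup] t01 /andP[t0 t1].
  have [L'' LL'' hL''] := cvx L L' t LLL LLL' t01.
  exists L'' => //; split.
  - rewrite hL''//; nra.
  - move=> j /[dup] jm /andP[_ jm']; rewrite hL''; last exact: leq_trans ml.
    have := cle j jm; have := c'le j jm; nra.
  - move=> j /[dup] jm /andP[_ jm']; rewrite hL''//.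
    by rewrite ceq// c'eq.
have C0 : C !=set0 by eexists; exact: (Cmem L0 1 LL0 ltr01).
have [[c [L LLL [c0 cle ceq]] cz]|] := convex_separation_origin l.+1 C0 Ccvx.
  have : h 0%N L <= p.
    apply: hp => // j /[dup] jm /andP[j0 jm'].
      by rewrite -(cz j) ?cle// ltnS (leq_trans jm').
    by rewrite ceq// cz.
  by move: c0; rewrite cz//; lra.
move=> [a [[i il ai] age0]].
have lsum (c : nat -> R) : \sum_(j < l.+1) a j * c j =
    a 0%N * c 0%N + \sum_(1 <= j < l.+1) a j * c j.
  by rewrite -(big_mkord xpredT (fun j => a j * c j)) big_nat_recl// big_add1.
have aL L s : LL L -> 0 < s -> 0 <= a 0%N * (p - h 0%N L + s) +
    \sum_(1 <= j < l.+1) a j * h j L.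
  move=> LLL s0; have := age0 _ (Cmem _ _ LLL s0).
  rewrite (lsum (fun j => if j == 0%N then p - h 0%N L + s else h j L))/=.
  by under eq_big_nat => j /andP[j0 _] do rewrite gtn_eqF//.
(* [C] contains a ray in each direction [k <= m], and a functional bounded below on it has a
   nonnegative coefficient there. *)
have ray (k : nat) : (k <= m)%N -> 0 <= a k.
  move=> km; rewrite leNgt; apply/negP => ak.
  pose c s j := (if j == 0%N then p - h 0%N L0 + 1 else h j L0) +
    s * (j == k)%:R.
  have Cc s : 0 < s -> C (c s).
    move=> s0; have [L LLL [L1 L2 L3]] := Cmem L0 1 LL0 ltr01.
    exists L => //; split=> [|j jm|j /andP[mj jl]]; rewrite /c.
    - by apply: (lt_le_trans L1); rewrite lerDl mulr_ge0// ltW.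
    - by apply: (le_trans (L2 _ jm)); rewrite lerDl mulr_ge0// ltW.
    - by rewrite L3 ?mj// (gtn_eqF (leq_ltn_trans km mj)) mulr0 addr0.
  pose A := \sum_(j < l.+1)
    a j * (if j == 0%N :> nat then p - h 0%N L0 + 1 else h j L0).
  have Ac s : \sum_(j < l.+1) a j * c s j = A + s * a k.
    rewrite /c; under eq_bigr do rewrite mulrDr; rewrite big_split/=.
    congr (_ + _); have kl : (k < l.+1)%N by rewrite ltnS (leq_trans km).
    rewrite (bigD1 (Ordinal kl))//= eqxx big1 ?addr0 ?mulr1 1?mulrC// => j jk.
    rewrite (_ : (j == k :> nat) = false) ?mulr0//.
    by apply: contraNF jk => /eqP jk; apply/eqP/val_inj.
  have A0 : 0 <= A by exact: age0 (Cmem L0 1 LL0 ltr01).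
  (* This is the [s] that solves [A + s * a k = - 1]. *)
  have s0 : 0 < (A + 1) / - a k by rewrite divr_gt0 ?oppr_gt0// ltr_wpDl.
  have := age0 _ (Cc _ s0); rewrite Ac (_ : _ + _ = - 1) ?oppr_ge0 ?ler10//.
  by field; rewrite lt_eqF.
have a0 : 0 < a 0%N.
  rewrite lt_neqAle ray// andbT eq_sym; apply/eqP => a00.
  have i0 : (1 <= i <= l)%N.
    by rewrite -(ltnS i) il andbT lt0n; apply: contra_neq ai => ->.
  have [|L LLL] := nondeg a _ (ex_intro2 _ _ i i0 ai).
    by move=> j /andP[_]; exact: ray.
  apply/negP; rewrite -leNgt.
  by have := aL L 1 LLL ltr01; rewrite a00 mul0r add0r.
exists (fun j => a j / a 0%N).
  by move=> j /andP[_ jm]; rewrite divr_ge0 ?ray// ltW.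
(* The slack [s] pays for the strict inequality in coordinate [0]; being arbitrary, it
   disappears. *)
move=> L LLL; apply/ler_addgt0Pr => s s0.
rewrite (eq_bigr (fun j => a j * h j L / a 0%N)); last by move=> j _; ring.
rewrite -mulr_suml; have := aL L s LLL s0.
set S := \sum_(1 <= j < l.+1) a j * h j L => aS.
have : 0 <= (a 0%N * (p - h 0%N L + s) + S) / a 0%N.
  by rewrite divr_ge0 // ltW.
rewrite mulrDl mulrAC divff ?gt_eqF// mul1r; lra.
Qed.


(* Diagonal dominance: the witness [V i s] moves the equality constraint [i] in
   the direction [(-1) ^+ s] by more than all other equality constraints can
   compensate, hence it defeats every multiplier whose largest equality entry is
   the [i]-th one. *)
Lemma nondegenerate_of_witnesses (T : Type) (m l : nat) (h : nat -> T -> R)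
    (L0 : T) (V : nat -> bool -> T) (eta : nat -> bool -> R) :
  (m <= l)%N ->
  (forall j, (1 <= j <= m)%N -> h j L0 < 0) ->
  (forall i s, (m < i <= l)%N -> [/\ 0 <= eta i s,
    l%:R * eta i s < (-1) ^+ s * h i (V i s),
    forall j, (1 <= j <= m)%N -> h j (V i s) < 0 &
    forall j, (m < j <= l)%N -> j != i -> `|h j (V i s)| <= eta i s]) ->
  forall lambda : nat -> R, (forall j, (1 <= j <= m)%N -> 0 <= lambda j) ->
  (exists2 j, (1 <= j <= l)%N & lambda j != 0) ->
  exists L, (L = L0 \/ exists i s, (m < i <= l)%N /\ L = V i s) /\
    \sum_(1 <= j < l.+1) lambda j * h j L < 0.
Proof.
move=> ml hL0 hV lambda lge0 [j0 /andP[j00 j0l] lj0].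
pose eq_idx := [pred i : 'I_l.+1 | (m < i)%N && (lambda i != 0)].
(* If all equality multipliers vanish, some inequality multiplier is positive and the Slater point
   [L0] suffices. *)
have [i0 mi0|eq0] := pickP eq_idx; last first.
  exists L0; split; first by left.
  have eq0' j : (m < j)%N -> (j < l.+1)%N -> lambda j = 0.
    by move=> mj jl; have := eq0 (Ordinal jl); rewrite /= mj/= => /negbFE/eqP.
  have j0m : (j0 <= m)%N.
    by rewrite leqNgt; apply: contraNN lj0 => mj; apply/eqP/eq0'.
  rewrite (bigD1_seq j0) ?iota_uniq ?mem_index_iota ?j00//=.
  rewrite -[ltRHS](addr0 0) ltr_leD//.
    rewrite nmulr_llt0 ?hL0 ?j00// lt_neqAle eq_sym lj0.
    by rewrite lge0// j00.
  rewrite big_seq_cond; apply: sumr_le0 => j; rewrite mem_index_iota.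
  move=> /andP[/andP[j1 jl] _]; have [jm|mj] := leqP j m.
    by rewrite mulr_ge0_le0 ?lge0 ?j1// ltW// hL0// j1.
  by rewrite eq0'// mul0r.
have [i /andP[mi li] imax] :=
  @arg_maxP _ R _ i0 eq_idx (fun i => `|lambda i|) mi0.
(* As an exponent of [-1], [true] asks for a decrease: the witness moves against the sign of
   [lambda i]. *)
pose s := 0 < lambda i.
have il : (i <= l)%N by rewrite -ltnS.
have mil : (m < i <= l)%N by rewrite mi.
have [eta0 hi hineq heq] := hV i s mil.
exists (V i s); split; first by right; exists i, s.
have li0 : 0 < `|lambda i| by rewrite normr_gt0.
have main : lambda i * h i (V i s) < - (l%:R * (`|lambda i| * eta i s)).
  have -> : lambda i * h i (V i s) =
      - (`|lambda i| * ((-1) ^+ s * h i (V i s))).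
    rewrite /s; case: (ltrgtP (lambda i) 0) li => //= lam _.
      by rewrite ltr0_norm// expr0 mul1r mulNr opprK.
    by rewrite gtr0_norm// expr1 mulN1r mulrN opprK.
  by rewrite ltrN2 mulrCA ltr_pM2l.
rewrite (bigD1_seq (i : nat)) ?iota_uniq ?mem_index_iota//=; last first.
  by rewrite (leq_ltn_trans _ mi)//= ltnS.
rewrite -ltrBrDr sub0r (lt_le_trans main)// lerN2.
rewrite big_mkcond/=.
(* All [l] indices receive the same bound, whence the factor [l] in the hypothesis on the
   witnesses. *)
apply: (@le_trans _ _ (\sum_(1 <= j < l.+1) `|lambda i| * eta i s)); last first.
  by rewrite sumr_const_nat subSS subn0 mulr_natl.
apply: ler_sum_nat => j /andP[j1 jl].
have b0 : 0 <= `|lambda i| * eta i s by rewrite mulr_ge0.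
case: ifPn => // ji; have [jm|mj] := leqP j m.
  apply: le_trans b0; rewrite mulr_ge0_le0 ?lge0 ?j1// ltW// hineq//.
  by rewrite j1.
apply: (le_trans (ler_norm _)); rewrite normrM ler_pM// ?heq// ?mj//.
have [->|lj] := eqVneq (lambda j) 0; first by rewrite normr0.
by have := imax (Ordinal jl); rewrite /= mj lj; exact.
Qed.

End lagrange_duality.

(** * Duality for a fixed sample *)

Section sample_duality.
Context {R : realType} {T : Type} (m l : nat) (phi : nat -> T -> R)
  (mu : nat -> R) (LL : set (T -> R)) (n : nat) (x : nat -> T).
Hypotheses (ml : (m <= l)%N) (n0 : (0 < n)%N).

(* [excess 0] is the objective; for [j >= 1] the [j]-th constraint reads
   [excess j <= 0] or [excess j = 0]. *)
Definition excess (j : nat) (L : T -> R) : R :=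
  sample_mean n x (fun y => phi j y * L y) - (if j == 0%N then 0 else mu j).

Lemma sample_mean_affine (j : nat) (L L' : T -> R) (t : R) :
  sample_mean n x (fun y => phi j y * (t * L y + (1 - t) * L' y)) =
  t * sample_mean n x (fun y => phi j y * L y) +
  (1 - t) * sample_mean n x (fun y => phi j y * L' y).
Proof.
rewrite /sample_mean [t * (n%:R^-1 * _)]mulrCA.
rewrite [(1 - t) * (n%:R^-1 * _)]mulrCA -[RHS]mulrDr.
congr (_ * _); rewrite !mulr_sumr -big_split/=.
by apply: eq_bigr => i _; ring.
Qed.

(** The constant [mu j] can leave the sample mean because [n] is positive; for [n = 0] every sample
    mean is zero. *)
Lemma sample_lagrangianE (lambda : nat -> R) (L : T -> R) :
  sample_lagrangian l phi mu n x lambda L =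
  excess 0%N L - \sum_(1 <= j < l.+1) lambda j * excess j L.
Proof.
rewrite /sample_lagrangian /excess eqxx subr0 /sample_mean.
rewrite sumrB mulrBr; congr (_ - _); rewrite exchange_big/= mulr_sumr.
apply: eq_big_nat => j /andP[j1 _]; rewrite gtn_eqF// -mulr_sumr sumrB.
rewrite sumr_const card_ord mulrCA mulrBr -[mu j *+ n]mulr_natl mulKf//.
by rewrite pnatr_eq0 -lt0n.
Qed.

Lemma sample_weak_duality :
  (primal_val m l phi mu LL n x <= dual_val m l phi mu LL n x)%E.
Proof.
apply: ge_ereal_sup => _ [L [LLL Lle Leq] <-].
apply: le_ereal_inf_tmp => _ [lambda lambda0 <-].
apply: le_trans (ereal_sup_ubound _); last by exists L.
rewrite lee_fin sample_lagrangianE /excess eqxx subr0 lerBrDr gerDl.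
rewrite big_seq; apply: sumr_le0 => j; rewrite mem_index_iota => /andP[j1 jl].
rewrite gtn_eqF//; have [jm|mj] := leqP j m.
  by rewrite mulr_ge0_le0 ?lambda0 ?j1// subr_le0 Lle// j1.
by rewrite Leq ?mj// subrr mulr0.
Qed.

Lemma sample_strong_duality (L0 : T -> R) (V : nat -> bool -> T -> R)
    (eta : nat -> bool -> R) :
  (forall L L' t, LL L -> LL L' -> 0 < t < 1 ->
    LL (fun y => t * L y + (1 - t) * L' y)) ->
  LL L0 -> (forall i s, (m < i <= l)%N -> LL (V i s)) ->
  (forall j, (1 <= j <= m)%N -> excess j L0 < 0) ->
  (forall i s, (m < i <= l)%N -> [/\ 0 <= eta i s,
    l%:R * eta i s < (-1) ^+ s * excess i (V i s),
    forall j, (1 <= j <= m)%N -> excess j (V i s) < 0 &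
    forall j, (m < j <= l)%N -> j != i -> `|excess j (V i s)| <= eta i s]) ->
  primal_val m l phi mu LL n x = dual_val m l phi mu LL n x.
Proof.
move=> cvx LL0 LLV L0neg hV; apply/eqP; rewrite eq_le sample_weak_duality/=.
(* Testing against real bounds [p] covers infinite values: an infeasible primal problem is bounded
   by every real, which forces the dual value to be [-oo]. *)
suff dual_le (p : R) : (primal_val m l phi mu LL n x <= p%:E)%E ->
    (dual_val m l phi mu LL n x <= p%:E)%E.
  case E : (primal_val m l phi mu LL n x) => [p| |].
  - by apply: dual_le; rewrite E.
  - by rewrite leey.
  - have dualNy p : (dual_val m l phi mu LL n x <= p%:E)%E.
      by apply: dual_le; rewrite E leNye.
    case: (dual_val m l phi mu LL n x) dualNy => [q /(_ (q - 1))|/(_ 0)|] //.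
    by rewrite lee_fin lerBrDr gerDl ler10.
move=> primal_le.
have [|||L LLL Lle Leq|lambda lambda0 Llambda] :=
    @lagrange_multiplier R _ LL m l excess p ml.
- by exists L0.
- move=> L L' t LLL LLL' t01.
  exists (fun y => t * L y + (1 - t) * L' y); first exact: cvx.
  by move=> j _; rewrite /excess sample_mean_affine; ring.
- move=> lambda lge0 lneq0.
  have [L [Lin Lneg]] := nondegenerate_of_witnesses ml L0neg hV lge0 lneq0.
  by exists L => //; case: Lin => [->//|[i [s [mi ->]]]]; exact: LLV.
- rewrite /excess eqxx subr0 -lee_fin; apply: le_trans primal_le.
  apply: ereal_sup_ubound; exists L => //; split=> // j /[dup] jm /andP[j1 _].
    by have := Lle j jm; rewrite /excess gtn_eqF// subr_le0.
  have j0 : (0 < j)%N by exact: leq_ltn_trans j1.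
  by have /eqP := Leq j jm; rewrite /excess gtn_eqF// subr_eq0 => /eqP.
apply: ge_ereal_inf; exists (ereal_sup
  [set (sample_lagrangian l phi mu n x lambda L)%:E | L in LL]).
  by exists lambda.
apply: ge_ereal_sup => _ [L LLL <-].
by rewrite lee_fin sample_lagrangianE; exact: Llambda.
Qed.

End sample_duality.

(** * The strong law of large numbers *)

Section dyadic_blocks.
Context {R : realType}.

(** An increasing geometric sum is at most twice its largest term. This will bound the expected
    number of truncated terms over all blocks. *)
Lemma dyadic_sum_lt (a n : nat) (z : R) : 0 <= z ->
  \sum_(k < n) (a * 2 ^ k)%:R * ((a * 2 ^ k)%:R < z)%R%:R <= 2 * z.
Proof.
(* The second bound carries the induction: the blocks before the [n]-th add up to at most its
   length. *)
move=> z0; suff : \sum_(k < n) (a * 2 ^ k)%:R * ((a * 2 ^ k)%:R < z)%R%:R <=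
    Num.min (2 * z) (a * 2 ^ n)%:R by rewrite le_min => /andP[].
elim: n => [|n IH]; first by rewrite big_ord0 le_min ler0n mulr_ge0.
rewrite big_ord_recr/= expnS mulnCA [(2 * _)%:R]natrM.
move: IH; rewrite !le_min => /andP[].
set N : R := (a * 2 ^ n)%:R; set s := \sum_(i < n) _.
have N0 : 0 <= N by exact: ler0n.
move=> s1 s2; case: (ltP N z) => zN /=; apply/andP; split; lra.
Qed.

(** Here the geometric series decreases and starts with a term of at most [z]. This will bound the
    sum of the truncated second moments divided by the block lengths. *)
Lemma dyadic_sum_ge (a n : nat) (z : R) : (0 < a)%N -> 0 <= z ->
  \sum_(k < n) (z ^+ 2 / (a * 2 ^ k)%:R) * (z <= (a * 2 ^ k)%:R)%R%:R <= 2 * z.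
Proof.
move=> a0 z0.
have N0 k : 0 < (a * 2 ^ k)%:R :> R by rewrite ltr0n muln_gt0 a0 expn_gt0.
(* One factor [z] is split off. The invariant is zero until the blocks reach [z]; afterwards it
   keeps the remaining geometric tail in reserve. *)
suff : \sum_(k < n) (z / (a * 2 ^ k)%:R) * (z <= (a * 2 ^ k)%:R)%R%:R <=
    Num.max 0 (2 - 2 * (z / (a * 2 ^ n)%:R)).
  move=> /(ler_wpM2l z0); rewrite mulr_sumr => h.
  rewrite (eq_bigr (fun k : 'I_n =>
      z * (z / (a * 2 ^ k)%:R * (z <= (a * 2 ^ k)%:R)%R%:R))); last first.
    by move=> k _; rewrite expr2 !mulrA.
  rewrite (le_trans h)// mulrC ler_wpM2r// ge_max ler0n/= lerBlDr lerDl.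
  by rewrite mulr_ge0// divr_ge0// ltW.
elim: n => [|n IH]; first by rewrite big_ord0 le_max lexx.
rewrite big_ord_recr/= expnS mulnCA [(2 * _)%:R]natrM.
move: IH; have := N0 n; set N : R := (a * 2 ^ n)%:R.
set s := \sum_(i < n) _ => N1.
have -> : 2 * (z / (2 * N)) = z / N by rewrite invfM mulrCA mulVKf ?pnatr_eq0.
rewrite !le_max; case: (leP z N) => zN.
  have : z / N <= 1 by rewrite ler_pdivrMr// mul1r.
  by rewrite /= => z1 /orP[s0|s2]; apply/orP; right; lra.
have : 1 < z / N by rewrite ltr_pdivlMr// mul1r.
by rewrite /= => z1 /orP[s0|s2]; apply/orP; left; lra.
Qed.

(* Every large [n] satisfies [a * 2 ^ k <= n < a.+1 * 2 ^ k] for some [k] and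
   some [q <= a < 2 * q], so the subsequences of those finitely many [a]
   determine the limit up to a factor [1 + 1 / q]. *)
Lemma cvg_dyadic_interpolation (s : nat -> R) (e : R) :
  nondecreasing_seq s -> (forall n, 0 <= s n) ->
  (forall a, (0 < a)%N ->
    s (a * 2 ^ k)%N / (a * 2 ^ k)%:R @[k --> \oo] --> e) ->
  s n / n%:R @[n --> \oo] --> e.
Proof.
move=> snd s0 scvg.
have e0 : 0 <= e.
  have c := scvg 1%N isT.
  rewrite -(cvg_lim _ c)//; apply: limr_ge; first exact: cvgP c.
  by apply: nearW => k; rewrite divr_ge0.
apply/cvgrPdist_lt => eps eps0.
(* The error will be at most [3 * eta]: one for the distance between block ends, two for the
   deviation at the upper end, which is at most [2 * n]. *)
pose eta := eps / 4.
have eta0 : 0 < eta by rewrite divr_gt0.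
pose q := (Num.bound (e / eta)).+1.
have eq : e / q%:R < eta.
  rewrite ltr_pdivrMr// -ltr_pdivrMl// mulrC.
  apply: (@lt_le_trans _ _ (Num.bound (e / eta))%:R).
    by rewrite archi_boundP// divr_ge0// ltW.
  by rewrite ler_nat.
(* The value [2 * q] is included because [a.+1] can reach it. *)
have [K Kcvg] : exists K, forall a, (q <= a <= q.*2)%N ->
    forall k, (K <= k)%N ->
    `|e - s (a * 2 ^ k)%N / (a * 2 ^ k)%:R| < eta.
  have : \forall k \near \oo, forall a : 'I_q.*2.+1, (q <= a)%N ->
      `|e - s (a * 2 ^ k)%N / (a * 2 ^ k)%:R| < eta.
    apply: filter_forall => a; case: (leqP q a) => qa; last first.
      by apply: nearW.
    have /cvgrPdist_lt/(_ eta eta0) := scvg a (leq_trans (ltn0Sn _) qa).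
    by apply: filterS.
  move=> [K _ KP]; exists K => a /andP[qa aq] k Kk.
  by have := KP k Kk (Ordinal (aq : (a < q.*2.+1)%N)) qa.
exists (q * 2 ^ K)%N => // n /= nK.
have q0 : (0 < q)%N by [].
have nq0 : (0 < n %/ q)%N.
  by rewrite divn_gt0// (leq_trans _ nK)// leq_pmulr// expn_gt0.
(* The largest [k] with [q * 2 ^ k <= n], which puts [n %/ 2 ^ k] between [q] and [2 * q]. *)
pose k := trunc_log 2 (n %/ q).
have /andP[k1 k2] := trunc_log_bounds (isT : (1 < 2)%N) nq0.
have Kk : (K <= k)%N.
  by rewrite trunc_log_max// leq_divRL// mulnC.
have pk0 : (0 < 2 ^ k)%N by rewrite expn_gt0.
pose a := (n %/ 2 ^ k)%N.
have qa : (q <= a)%N by rewrite leq_divRL// mulnC -leq_divRL.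
have aq : (a < q.*2)%N.
  by rewrite ltn_divLR// -muln2 -mulnA -expnS mulnC -ltn_divLR.
have an : (a * 2 ^ k <= n)%N by exact: leq_trunc_div.
have na : (n < a.+1 * 2 ^ k)%N by rewrite -ltn_divLR.
have n0 : 0 < n%:R :> R.
  by rewrite ltr0n (leq_trans _ an)// muln_gt0 pk0 (leq_trans _ qa).
have mean_dist b : (q <= b <= q.*2)%N ->
    `|e * (b * 2 ^ k)%:R - s (b * 2 ^ k)%N| < eta * (b * 2 ^ k)%:R.
  move=> qb; have := Kcvg b qb k Kk; have b0 : 0 < (b * 2 ^ k)%:R :> R.
    by rewrite ltr0n muln_gt0 pk0 andbT; case/andP: qb => /(leq_trans q0).
  rewrite -(ltr_pM2r b0) -[X in _ * X < _](gtr0_norm b0) -normrM mulrBl.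
  by rewrite divfK// gt_eqF.
have := mean_dist a; have := mean_dist a.+1.
rewrite qa (leqW qa) aq (ltnW aq) => /(_ isT) + /(_ isT).
have := snd _ _ an; have := snd _ _ (ltnW na).
have : (n%:R : R) <= (a.+1 * 2 ^ k)%:R by rewrite ler_nat ltnW.
have : (a * 2 ^ k)%:R <= n%:R :> R by rewrite ler_nat.
have : (q%:R * (2 ^ k)%:R : R) <= (a * 2 ^ k)%:R.
  by rewrite -natrM ler_nat leq_mul2r qa orbT.
have : 1 <= q%:R :> R by rewrite ler1n.
have : 1 <= (2 ^ k)%:R :> R by rewrite ler1n.
rewrite ltr_pdivrMr ?ltr0n// in eq.
rewrite mulSn [(2 ^ k + _)%:R]natrD.
have -> : eps = 4 * eta by rewrite /eta mulrC divfK.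
move: eq eta0 e0 n0; clear.
move: (a * 2 ^ k)%:R (s (a * 2 ^ k)%N) (s (2 ^ k + a * 2 ^ k)%N) (s n).
move: n%:R (2 ^ k)%:R q%:R => N U Q A sA sB sN.
move=> eQ eta0 e0 N0 U1 Q1 QU AN NB sNB sAN hB hA.
have UN : U <= N by nra.
(* Since [2 ^ k] is at most [n / q], passing to the next block end changes [e * n] by at most
   [eta * n]. *)
have eUN : e * U <= eta * N.
  have : 0 <= (eta * Q - e) * U by rewrite mulr_ge0; lra.
  have : 0 <= eta * (A - Q * U) by rewrite mulr_ge0; lra.
  have : 0 <= eta * (N - A) by rewrite mulr_ge0; lra.
  lra.
move: hA hB; rewrite !ltr_distl => /andP[A1 A2] /andP[B1 B2].
rewrite ltrBlDr -[X in _ && X]ltrBlDr ltr_pdivrMr// ltr_pdivlMr//.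
have := ler_wpM2l e0 AN; have := ler_wpM2l e0 NB.
have := ler_wpM2l (ltW eta0) AN; have := ler_wpM2l (ltW eta0) UN.
by move=> *; apply/andP; split; lra.
Qed.

End dyadic_blocks.

(** * Second-moment bounds and almost sure convergence *)

Section law_of_large_numbers.
Context {d} {T : measurableType d} {R : realType}.

(** By Tonelli the sum of the [f k] is integrable, hence finite almost everywhere, so its terms tend
    to zero. This takes the place of Chebyshev with Borel-Cantelli. *)
Lemma ae_cvg0_summable_integral (mu : {measure set T -> \bar R})
    (f : nat -> T -> R) :
  (forall k, measurable_fun setT (f k)) -> (forall k x, 0 <= f k x) ->
  (\sum_(k <oo) \int[mu]_x (f k x)%:E < +oo)%E ->
  {ae mu, forall x, f k x @[k --> \oo] --> (0 : R)}.
Proof.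
move=> mf f0 sumf.
have mfE k : measurable_fun setT (EFin \o f k) by exact/measurable_EFinP.
have f0E x : (0 <= \sum_(k <oo) (f k x)%:E)%E.
  by apply: nneseries_ge0 => k _ _; rewrite lee_fin.
have : mu.-integrable setT (fun x => \sum_(k <oo) (f k x)%:E)%E.
  apply/integrableP; split.
    apply: ge0_emeasurable_sum => [k x _ _|k _]; last exact: mfE.
    by rewrite lee_fin.
  under eq_integral do rewrite gee0_abs//.
  by rewrite integral_nneseries// => k x _; rewrite lee_fin.
move/integrable_ae => /(_ measurableT); apply: filterS => x /(_ I) sfin.
apply: cvg_series_cvg_0; apply: nondecreasing_is_cvgn.
  by apply/nondecreasing_seqP => n; rewrite seriesSr lerDl.
exists (fine (\sum_(k <oo) (f k x)%:E)) => _ [n _ <-].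
rewrite -lee_fin fineK// /series/= -sumEFin.
by apply: nneseries_lim_ge => k _; rewrite lee_fin.
Qed.

Variable P : probability T R.

(** Independence makes the joint law the product of the two laws, by uniqueness on rectangles;
    Tonelli then separates the integral. *)
Lemma ge0_integral_mul_independent d' (T' : measurableType d')
    (Y Z : {mfun T >-> T'}) (f g : T' -> \bar R) :
  (forall A B, measurable A -> measurable B ->
    P (Y @^-1` A `&` Z @^-1` B) = P (Y @^-1` A) * P (Z @^-1` B))%E ->
  measurable_fun setT f -> measurable_fun setT g ->
  (forall y, 0 <= f y)%E -> (forall y, 0 <= g y)%E ->
  (\int[P]_x (f (Y x) * g (Z x)) =
   \int[P]_x f (Y x) * \int[P]_x g (Z x))%E.
Proof.
move=> YZ mf mg f0 g0.
pose YZp x := (Y x, Z x).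
have mYZ : measurable_fun setT YZp by exact/measurable_fun_pair.
pose YZm : {mfun T >-> (T' * T')%type} := mfun_Sub (mem_set mYZ).
pose h (p : T' * T') := (f p.1 * g p.2)%E.
have mh : measurable_fun setT h.
  by apply: emeasurable_funM; exact: measurableT_comp.
have h0 p : (0 <= h p)%E by exact: mule_ge0.
transitivity (\int[distribution P YZm]_p h p)%E.
  by rewrite ge0_integral_distribution.
transitivity (\int[distribution P Y \x distribution P Z]_p h p)%E.
  apply: eq_measure_integral => A mA _.
  by apply/esym/product_measure_unique => // B C mB mC; exact: YZ.
rewrite fubini_tonelli1// /fubini_F /h /=.
under eq_integral do rewrite ge0_integralZl//.
by rewrite ge0_integralZr// ?integral_ge0// !ge0_integral_distribution.
Qed.

Variable Z : nat -> {mfun T >-> R}.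
Hypothesis pairwise_indep : forall i j, i != j -> forall A B : set R,
  measurable A -> measurable B ->
  (P (Z i @^-1` A `&` Z j @^-1` B) = P (Z i @^-1` A) * P (Z j @^-1` B))%E.
Hypothesis identically_distributed : forall i (A : set R), measurable A ->
  P (Z i @^-1` A) = P (Z 0%N @^-1` A).

Lemma ge0_integral_identically_distributed i (f : R -> \bar R) :
  measurable_fun setT f -> (forall y, 0 <= f y)%E ->
  (\int[P]_x f (Z i x) = \int[P]_x f (Z 0%N x))%E.
Proof.
move=> mf f0; rewrite -!(ge0_integral_distribution (P := P) (Z _) mf f0).
by apply: eq_measure_integral => A mA _; exact: identically_distributed.
Qed.

(** Pairwise independence removes the covariances, so the variance of the mean is
    [(q - e ^+ 2) / N]. *)
Lemma variance_sample_mean_le (f : R -> R) (e q : R) (N : nat) :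
  measurable_fun setT f -> (forall y, 0 <= f y) ->
  (\int[P]_x (f (Z 0%N x))%:E = e%:E)%E ->
  (\int[P]_x (f (Z 0%N x) ^+ 2)%:E = q%:E)%E ->
  (0 < N)%N ->
  (\int[P]_x (((\sum_(i < N) f (Z i x)) / N%:R - e) ^+ 2)%:E <=
   (q / N%:R)%:E)%E.
Proof.
move=> mf f0 fe fq N0.
have mfE : measurable_fun setT (EFin \o f) by exact/measurable_EFinP.
have mfZ i : measurable_fun setT (fun x => f (Z i x)).
  exact: measurableT_comp.
have mfZE i : measurable_fun setT (fun x => (f (Z i x))%:E).
  exact/measurable_EFinP.
pose S x := \sum_(i < N) f (Z i x).
have mS : measurable_fun setT S by exact: measurable_sum.
have S0 x : 0 <= S x by exact: sumr_ge0.
have e0 : 0 <= e.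
  by rewrite -lee_fin -fe integral_ge0// => x _; rewrite lee_fin.
have intf i : (\int[P]_x (f (Z i x))%:E = e%:E)%E.
  by rewrite -fe (ge0_integral_identically_distributed i mfE).
have intff i j : (\int[P]_x (f (Z i x) * f (Z j x))%:E =
    (if i == j then q else e ^+ 2)%:E)%E.
  have [->|ij] := eqVneq i j.
    rewrite -fq; under eq_integral do rewrite -expr2.
    rewrite (ge0_integral_identically_distributed j
      (f := fun y => (f y ^+ 2)%:E)) //.
      by apply/measurable_EFinP; exact: measurable_funX.
    by move=> y; rewrite lee_fin sqr_ge0.
  under eq_integral do rewrite EFinM.
  rewrite (ge0_integral_mul_independent (pairwise_indep ij) mfE mfE)//.
  by rewrite !intf.
have intS : (\int[P]_x (S x)%:E = (N%:R * e)%:E)%E.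
  under eq_integral do rewrite /S -sumEFin.
  rewrite ge0_integral_sum//; last by move=> i x _; rewrite lee_fin.
  under eq_bigr do rewrite intf.
  by rewrite sumEFin sumr_const card_ord mulr_natl.
(* The [N] diagonal pairs contribute [q] each, all other pairs [e ^+ 2]. *)
have intS2 : (\int[P]_x (S x ^+ 2)%:E =
    (N%:R * q + (N%:R ^+ 2 - N%:R) * e ^+ 2)%:E)%E.
  have S2E x : (S x ^+ 2)%:E =
      (\sum_(i < N) \sum_(j < N) (f (Z i x) * f (Z j x))%:E)%E.
    rewrite expr2 /S mulr_suml -sumEFin; apply: eq_bigr => i _.
    by rewrite mulr_sumr -sumEFin.
  under eq_integral do rewrite S2E.
  have mff i j : measurable_fun setT (fun x => (f (Z i x) * f (Z j x))%:E).
    by apply/measurable_EFinP; exact: measurable_funM.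
  rewrite ge0_integral_sum//; last 2 first.
    by move=> i; exact: emeasurable_sum.
    by move=> i x _; apply: sume_ge0 => j _; rewrite lee_fin mulr_ge0.
  have rowE (i : 'I_N) : (\int[P]_x (\sum_(j < N) (f (Z i x) * f (Z j x))%:E) =
      (q + (N%:R - 1) * e ^+ 2)%:E)%E.
    rewrite ge0_integral_sum//; last by move=> j x _; rewrite lee_fin mulr_ge0.
    under eq_bigr do rewrite intff.
    rewrite sumEFin (bigD1 i)//= eqxx; congr (_ + _)%:E.
    rewrite (eq_bigr (fun=> e ^+ 2)); last first.
      by move=> j ji; rewrite ifF// eq_sym; apply/negbTE.
    rewrite sumr_const cardC1 card_ord -subn1 mulrnBr//.
    by rewrite mulrBl mulr_natl mul1r.
  under eq_bigr do rewrite rowE.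
  rewrite sumEFin sumr_const card_ord -mulr_natl; congr EFin; ring.
have N0R : (N%:R : R) != 0 by rewrite pnatr_eq0 -lt0n.
pose D x := (S x / N%:R - e) ^+ 2.
have mD : measurable_fun setT (fun x => (D x)%:E).
  apply/measurable_EFinP/measurable_funX/measurable_funB => //.
  exact: measurable_funM.
(* [2 * e * S / N] is added on both sides to keep all integrands nonnegative *)
have key : (\int[P]_x (D x)%:E + (2 * e ^+ 2)%:E =
    ((q - e ^+ 2) / N%:R + 2 * e ^+ 2)%:E)%E.
  transitivity (\int[P]_x ((D x)%:E + (2 * e / N%:R)%:E * (S x)%:E))%E.
    rewrite ge0_integralD//; last 3 first.
    - by move=> x _; rewrite lee_fin sqr_ge0.
    - by move=> x _; rewrite -EFinM lee_fin mulr_ge0// divr_ge0// mulr_ge0.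
    - by apply/measurable_EFinP/measurable_funM.
    - rewrite ge0_integralZl_EFin ?divr_ge0 ?mulr_ge0//; last 2 first.
      + by move=> x _; rewrite lee_fin.
      + exact/measurable_EFinP.
      rewrite intS -EFinM; congr (_ + _%:E)%E; by field.
  transitivity (\int[P]_x ((N%:R ^- 2)%:E * (S x ^+ 2)%:E + (e ^+ 2)%:E))%E.
    apply: eq_integral => x _; rewrite -!EFinM -!EFinD /D; congr EFin; by field.
  have mS2 : measurable_fun setT (fun x => (S x ^+ 2)%:E).
    by apply/measurable_EFinP; exact: measurable_funX.
  rewrite ge0_integralD//; last 3 first.
    move=> x _; rewrite -EFinM lee_fin.
    by rewrite mulr_ge0 ?sqr_ge0// invr_ge0 exprn_ge0.
    by apply: emeasurable_funM.
    by move=> x _; rewrite lee_fin sqr_ge0.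
  rewrite ge0_integralZl_EFin ?invr_ge0 ?exprn_ge0//; last first.
    by move=> x _; rewrite lee_fin sqr_ge0.
  rewrite intS2 integral_cst//= probability_setT mule1 -EFinM -EFinD.
  by congr EFin; field.
have -> : (\int[P]_x (D x)%:E = ((q - e ^+ 2) / N%:R)%:E)%E.
  have /(congr1 (fun z => z - (2 * e ^+ 2)%:E)%E) := key.
  by rewrite addeK// -EFinB addrK.
by rewrite lee_fin ler_pM2r ?invr_gt0 ?ltr0n// lerBlDr lerDl sqr_ge0.
Qed.

Lemma nneseries_integral_le (mu : {measure set T -> \bar R})
    (f : nat -> T -> R) (h : T -> R) :
  (forall k, measurable_fun setT (f k)) -> measurable_fun setT h ->
  (forall k x, 0 <= f k x) ->
  (forall n x, \sum_(k < n) f k x <= h x) ->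
  (\sum_(k <oo) \int[mu]_x (f k x)%:E <= \int[mu]_x (h x)%:E)%E.
Proof.
move=> mf mh f0 fh.
have mfE k : measurable_fun setT (fun x => (f k x)%:E).
  exact/measurable_EFinP.
apply: lime_le.
  apply: is_cvg_nneseries => k _ _; apply: integral_ge0 => x _.
  by rewrite lee_fin.
apply: nearW => n.
rewrite -ge0_integral_sum//; last by move=> k x _; rewrite lee_fin.
apply: ge0_le_integral => //=.
- by move=> x _; apply: sume_ge0 => k _; rewrite lee_fin.
- exact: emeasurable_sum.
- exact/measurable_EFinP.
- by move=> x _; rewrite sumEFin lee_fin big_mkord.
Qed.

(** The lower cutoff makes [trunc] nonnegative on all of [R], as [variance_sample_mean_le] demands;
    on the nonnegative [Z i] only the upper one acts. *)
Let trunc (N : nat) (z : R) := z * (0 <= z <= N%:R)%R%:R.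

Let trunc_ge0 N z : 0 <= trunc N z.
Proof.
by rewrite /trunc; case: andP => [[z0 _]|_]; rewrite ?mulr1 ?mulr0.
Qed.

Let measurable_trunc N : measurable_fun setT (trunc N).
Proof.
apply: measurable_funM => //.
rewrite (_ : (fun z : R => (0 <= z <= N%:R)%R%:R : R) =
  (\1_(`[0, N%:R]%classic : set R) : R -> R)).
  by apply: measurable_indic.
apply/funext => z; rewrite indicE; congr (nat_of_bool _)%:R.
by rewrite mem_setE in_itv.
Qed.

Hypothesis Z_ge0 : forall i x, 0 <= Z i x.
Variable e : R.
Hypothesis mean_Z : (\int[P]_x (Z 0%N x)%:E = e%:E)%E.

Let truncE N i x : trunc N (Z i x) = Z i x * (Z i x <= N%:R)%R%:R.
Proof. by rewrite /trunc Z_ge0. Qed.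

(* Etemadi's argument: along [N k = a * 2 ^ k] the variances of the means
   truncated at [N k], and the expected numbers [B k] of truncated terms, are
   both summable by the geometric bounds above. *)
Lemma slln_dyadic (a : nat) : (0 < a)%N ->
  {ae P, forall x,
    (\sum_(i < a * 2 ^ k) Z i x) / (a * 2 ^ k)%:R @[k --> \oo] --> e}.
Proof.
move=> a0; pose N k := (a * 2 ^ k)%N.
have N0 k : (0 < N k)%N by rewrite muln_gt0 a0 expn_gt0.
have N0R k : 0 < (N k)%:R :> R by rewrite ltr0n.
have mtZ k : measurable_fun setT (fun x => trunc (N k) (Z 0%N x)).
  by apply: measurableT_comp => //; exact: measurable_trunc.
have trunc_le k x : trunc (N k) (Z 0%N x) <= Z 0%N x.
  by rewrite truncE; case: (Z 0%N x <= _); rewrite ?mulr1// mulr0.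
have mZE : measurable_fun setT (fun x => (Z 0%N x)%:E).
  exact/measurable_EFinP.
have mtZE k : measurable_fun setT (fun x => (trunc (N k) (Z 0%N x))%:E).
  exact/measurable_EFinP.
pose ek k := fine (\int[P]_x (trunc (N k) (Z 0%N x))%:E)%E.
have ekE k : (\int[P]_x (trunc (N k) (Z 0%N x))%:E = (ek k)%:E)%E.
  rewrite fineK// ge0_fin_numE; last first.
    by apply: integral_ge0 => x _; rewrite lee_fin.
  apply: (@le_lt_trans _ _ e%:E); last exact: ltry.
  rewrite -mean_Z; apply: ge0_le_integral => // x _; rewrite lee_fin//.
(* Monotone convergence: the levels [N k] increase and exceed [k]. *)
have ek_cvg : ek k @[k --> \oo] --> e.
  apply: fine_cvg; rewrite -mean_Z.
  have tlim x : (trunc (N k) (Z 0%N x))%:E @[k --> \oo] --> (Z 0%N x)%:E.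
    apply: cvg_near_cst; near=> k; rewrite truncE (_ : _ <= _) ?mulr1//.
    have k_large : Z 0%N x <= k%:R by near: k; exact: nbhs_infty_ger.
    apply: (le_trans k_large); rewrite ler_nat /N.
    by rewrite (leq_trans (ltnW (ltn_expl k (isT : (1 < 2)%N))))// leq_pmull.
  rewrite (eq_integral
      (fun x => lim ((trunc (N k) (Z 0%N x))%:E @[k --> \oo])));
    last by move=> x _; apply/esym/cvg_lim => //; exact: tlim.
  apply: (@cvg_monotone_convergence _ _ _ P setT measurableT
    (fun k x => (trunc (N k) (Z 0%N x))%:E)) => //.
  + by move=> k x _; rewrite lee_fin.
  + move=> x _ k k' kk'; rewrite lee_fin !truncE ler_wpM2l// ler_nat.
    have [zN|//] := leP (Z 0%N x) (N k)%:R.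
    by rewrite (le_trans zN)// ler_nat leq_pmul2l// leq_exp2l.
pose q k := fine (\int[P]_x (trunc (N k) (Z 0%N x) ^+ 2)%:E)%E.
have mt2 k : measurable_fun setT (fun x => (trunc (N k) (Z 0%N x) ^+ 2)%:E).
  by apply/measurable_EFinP; exact: measurable_funX.
have qE k : (\int[P]_x (trunc (N k) (Z 0%N x) ^+ 2)%:E = (q k)%:E)%E.
  rewrite fineK// ge0_fin_numE; last first.
    by apply: integral_ge0 => x _; rewrite lee_fin sqr_ge0.
  (* Below the cutoff a square is at most [N k] times the value, so a finite mean suffices. *)
  apply: (@le_lt_trans _ _ ((N k)%:R * e)%:E); last exact: ltry.
  rewrite EFinM -mean_Z -ge0_integralZl_EFin//; last first.
    by move=> x _; rewrite lee_fin.
  apply: ge0_le_integral => //=.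
  - by move=> x _; rewrite lee_fin sqr_ge0.
  - by apply: emeasurable_funM.
  - move=> x _; rewrite -EFinM lee_fin truncE.
    case: (leP (Z 0%N x) (N k)%:R) => zN; last by rewrite mulr0 expr0n mulr_ge0.
    by rewrite mulr1 expr2 ler_wpM2r.
pose D k x := ((\sum_(i < N k) trunc (N k) (Z i x)) / (N k)%:R - ek k) ^+ 2.
have mtrZ k i : measurable_fun setT (fun x => trunc (N k) (Z i x)).
  by apply: measurableT_comp => //; exact: measurable_trunc.
have D_cvg : {ae P, forall x, D k x @[k --> \oo] --> (0 : R)}.
  apply: ae_cvg0_summable_integral.
  - move=> k; apply: measurable_funX; apply: measurable_funB => //.
    by apply: measurable_funM => //; exact: measurable_sum.
  - by move=> k x; exact: sqr_ge0.
  apply: (@le_lt_trans _ _ (2 * e)%:E); last exact: ltry.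
  rewrite EFinM -mean_Z -ge0_integralZl_EFin//; last first.
    by move=> x _; rewrite lee_fin.
  (* The integral of [f k] bounds that of [D k], and the [f k] sum pointwise to at most
     [2 * Z 0]. *)
  pose f k x := (Z 0%N x ^+ 2 / (N k)%:R) * (Z 0%N x <= (N k)%:R)%R%:R.
  have fE k x : f k x = trunc (N k) (Z 0%N x) ^+ 2 / (N k)%:R.
    rewrite /f truncE; case: (_ <= _); rewrite ?mulr1//.
    by rewrite !mulr0 expr0n mul0r.
  apply: (@le_trans _ _ (\sum_(k <oo) \int[P]_x (f k x)%:E)%E).
    apply: lee_nneseries => [k _ _|k _].
      by apply: integral_ge0 => x _; rewrite lee_fin sqr_ge0.
    apply: le_trans (variance_sample_mean_le (measurable_trunc (N k))
      (trunc_ge0 (N k)) (ekE k) (qE k) (N0 k)) _.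
    under eq_integral do rewrite fE mulrC EFinM.
    rewrite ge0_integralZl_EFin//; last by move=> x _; rewrite lee_fin sqr_ge0.
    by rewrite qE -EFinM mulrC.
  under [leRHS]eq_integral do rewrite -EFinM.
  apply: nneseries_integral_le => [k| |k x|n x].
  - rewrite (_ : f k = (fun x => trunc (N k) (Z 0%N x) ^+ 2 / (N k)%:R)).
      by apply: measurable_funM => //; exact: measurable_funX.
    by apply/funext => x; exact: fE.
  - exact: measurable_funM.
  - by rewrite fE divr_ge0// ?sqr_ge0// ltW.
  - exact: dyadic_sum_ge.
pose B k x := \sum_(i < N k) ((N k)%:R < Z i x)%R%:R : R.
have mltR0 k : measurable_fun setT (fun y : R => ((N k)%:R < y)%R%:R : R).
  rewrite (_ : (fun y : R => _) =
      (\1_(`](N k)%:R, +oo[%classic : set R) : R -> R)).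
    exact: measurable_indic.
  apply/funext => y /=; rewrite indicE; congr (nat_of_bool _)%:R.
  by rewrite mem_setE in_itv/= andbT.
have mlt k i : measurable_fun setT (fun x => ((N k)%:R < Z i x)%R%:R : R).
  exact: (measurableT_comp (mltR0 k)).
have B_cvg : {ae P, forall x, B k x @[k --> \oo] --> (0 : R)}.
  apply: ae_cvg0_summable_integral.
  - by move=> k; exact: measurable_sum.
  - by move=> k x; exact: sumr_ge0.
  apply: (@le_lt_trans _ _ (2 * e)%:E); last exact: ltry.
  rewrite EFinM -mean_Z -ge0_integralZl_EFin//; last first.
    by move=> x _; rewrite lee_fin.
  pose f k x := (N k)%:R * ((N k)%:R < Z 0%N x)%R%:R : R.
  have BE k : (\int[P]_x (B k x)%:E = \int[P]_x (f k x)%:E)%E.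
    under eq_integral do rewrite /B -sumEFin.
    rewrite ge0_integral_sum//; last by move=> i; exact/measurable_EFinP.
    have mltR : measurable_fun setT
        (fun y : R => ((N k)%:R < y)%R%:R%:E : \bar R).
      by apply/measurable_EFinP; exact: mltR0.
    under eq_bigr => i _ do
      rewrite (ge0_integral_identically_distributed i mltR)//.
    under [RHS]eq_integral do rewrite /f EFinM.
    rewrite ge0_integralZl_EFin//; last exact/measurable_EFinP.
    by rewrite sumr_const card_ord mule_natl.
  rewrite (eq_eseriesr (fun k _ => BE k)).
  under [leRHS]eq_integral do rewrite -EFinM.
  apply: nneseries_integral_le => [k| |k x|n x].
  - exact: measurable_funM.
  - exact: measurable_funM.
  - exact: mulr_ge0.
  - exact: dyadic_sum_lt.
apply: filterS2 D_cvg B_cvg => x Dx Bx.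
have Tx : (\sum_(i < N k) trunc (N k) (Z i x)) / (N k)%:R - ek k
    @[k --> \oo] --> (0 : R).
  apply/cvgr0Pnorm_lt => eps eps0.
  have /cvgr_lt/(_ (eps ^+ 2) (exprn_gt0 2 eps0)) :
    D k x @[k --> \oo] --> (0 : R) by [].
  apply: filterS => k Dk.
  by rewrite -(@ltr_pXn2r _ 2)// ?nnegrE ?(ltW eps0)// real_normK ?num_real.
have Tx' : (\sum_(i < N k) trunc (N k) (Z i x)) / (N k)%:R @[k --> \oo] --> e.
  have Te := cvgD Tx ek_cvg; rewrite add0r in Te.
  apply: cvg_trans; last exact: Te.
  by apply: near_eq_cvg; apply: nearW => k /=; rewrite subrK.
apply: cvg_trans; last exact: Tx'.
apply: near_eq_cvg.
(* [B k x] is a count: once below [1] it is zero, and truncation at [N k] changes no term of the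
   block. *)
have /cvgr_lt/(_ 1 ltr01) : B k x @[k --> \oo] --> (0 : R) by [].
apply: filterS => k Bk; congr (_ / _); apply: eq_bigr => i _; rewrite truncE.
have [//|Nz] := leP (Z i x) (N k)%:R; rewrite ?mulr1//.
move: Bk; rewrite /B (bigD1 i)//= Nz ltNge => /negP[].
by rewrite lerDl sumr_ge0.
Unshelve. all: by end_near. Qed.

(** Nonnegativity makes the partial sums monotone, so the dyadic subsequences decide; countably many
    [a] cost only a null set. *)
Lemma slln_ge0 :
  {ae P, forall x, (\sum_(i < n) Z i x) / n%:R @[n --> \oo] --> e}.
Proof.
have /ae_foralln : forall a, {ae P, forall x,
    (\sum_(i < a.+1 * 2 ^ k) Z i x) / (a.+1 * 2 ^ k)%:R @[k --> \oo] --> e}.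
  by move=> a; exact: slln_dyadic.
apply: filterS => x dyadic.
apply: (@cvg_dyadic_interpolation _ (fun n => \sum_(i < n) Z i x)).
- apply/nondecreasing_seqP => n; rewrite big_ord_recr/= lerDl; exact: Z_ge0.
- by move=> n; apply: sumr_ge0 => i _; exact: Z_ge0.
- by case.
Qed.

End law_of_large_numbers.

(** The positive and negative parts are Borel images of the [Z i], so they inherit pairwise
    independence and a common law, and [slln_ge0] applies to each. *)
Theorem strong_law_of_large_numbers d (T : measurableType d) (R : realType)
    (P : probability T R) (Z : nat -> {mfun T >-> R}) :
  (forall i j, i != j -> forall A B : set R, measurable A -> measurable B ->
    (P (Z i @^-1` A `&` Z j @^-1` B) = P (Z i @^-1` A) * P (Z j @^-1` B))%E) ->
  (forall i (A : set R), measurable A ->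
    P (Z i @^-1` A) = P (Z 0%N @^-1` A)) ->
  P.-integrable setT (EFin \o Z 0%N) ->
  {ae P, forall x, (\sum_(i < n) Z i x) / n%:R @[n --> \oo] -->
    \int[P]_x Z 0%N x}.
Proof.
move=> indep ident intZ.
have part (h : R -> R) : measurable_fun setT h -> (forall y, 0 <= h y) ->
    P.-integrable setT (EFin \o (h \o Z 0%N)) ->
    {ae P, forall x, (\sum_(i < n) h (Z i x)) / n%:R @[n --> \oo] -->
      \int[P]_x h (Z 0%N x)}.
  move=> mh h0 inth.
  have mhZ i : measurable_fun setT (h \o Z i) by exact: measurableT_comp.
  pose W i : {mfun T >-> R} := mfun_Sub (mem_set (mhZ i)).
  have mpre A : measurable A -> measurable (h @^-1` A).
    by move=> mA; rewrite -[X in measurable X]setTI; exact: mh.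
  apply: (@slln_ge0 _ _ _ P W _ _ _ (\int[P]_x h (Z 0%N x))).
  - move=> i j ij A B mA mB.
    exact: (indep i j ij (h @^-1` A) (h @^-1` B) (mpre _ mA) (mpre _ mB)).
  - by move=> i A mA; exact: (ident i (h @^-1` A) (mpre _ mA)).
  - by move=> i x; exact: h0.
  - by rewrite /Rintegral fineK// (integrable_fin_num measurableT inth).
have mpos : measurable_fun setT (fun y : R => Num.max y 0).
  exact: measurable_maxr.
have mneg : measurable_fun setT (fun y : R => Num.max (- y) 0).
  by apply: measurable_maxr => //; exact: oppr_measurable.
have ipos : P.-integrable setT (EFin \o ((fun y => Num.max y 0) \o Z 0%N)).
  by have := integrable_funrpos measurableT intZ.
have ineg : P.-integrable setT (EFin \o ((fun y => Num.max (- y) 0) \o Z 0%N)).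
  by have := integrable_funrneg measurableT intZ.
have maxB (y : R) : y = Num.max y 0 - Num.max (- y) 0.
  case/orP: (le_total 0 y) => y0.
    by rewrite (max_l y0) max_r ?subr0// oppr_le0.
  by rewrite (max_r y0) max_l ?sub0r ?opprK// oppr_ge0.
have le_max0 (y : R) : 0 <= Num.max y 0 by rewrite le_max lexx orbT.
apply: filterS2 (part _ mpos le_max0 ipos)
  (part _ mneg (fun y => le_max0 _) ineg).
move=> x cpos cneg.
have -> : \int[P]_x Z 0%N x =
    \int[P]_x Num.max (Z 0%N x) 0 - \int[P]_x Num.max (- Z 0%N x) 0.
  by rewrite -RintegralB//; apply: eq_Rintegral => y _; exact: maxB.
apply: cvg_trans; last exact: cvgB cpos cneg.
apply: near_eq_cvg; apply: nearW => n.
transitivity ((\sum_(i < n) Num.max (Z i x) 0) / n%:R -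
  (\sum_(i < n) Num.max (- Z i x) 0) / n%:R) => //.
by rewrite -mulrBl -sumrB; congr (_ / _); apply: eq_bigr => i _; rewrite -maxB.
Qed.

(** * Sample means under a density *)

Section integral_density.
Context d {T : measurableType d} {R : realType}.
Variables (nu : {finite_measure set T -> \bar R})
  (mu : {sigma_finite_measure set T -> \bar R}) (g : T -> R).
Hypotheses (mg : measurable_fun setT g) (g0 : forall x, 0 <= g x).
Hypothesis nuE : forall B, measurable B ->
  nu B = (\int[mu]_(x in B) (g x)%:E)%E.

(** [g] agrees almost everywhere with the Radon-Nikodym derivative of [nu], both having the same
    integral over every measurable set. A signed [f] is split into its positive and negative
    parts. *)
Lemma integral_density (f : T -> \bar R) : measurable_fun setT f ->
  (\int[nu]_x f x = \int[mu]_x (f x * (g x)%:E))%E.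
Proof.
move=> mf.
have mgE : measurable_fun setT (EFin \o g) by exact/measurable_EFinP.
have numu : nu `<< mu.
  apply/null_content_dominatesP => A mA A0.
  by rewrite nuE// null_set_integral//; exact: measurable_funTS.
have gE : ae_eq mu setT (Radon_Nikodym_SigmaFinite.f nu mu) (EFin \o g).
  apply: integral_ae_eq => //.
    exact: Radon_Nikodym_SigmaFinite.f_integrable.
  by move=> A _ mA; rewrite -Radon_Nikodym_SigmaFinite.f_integral// nuE.
have mRN : measurable_fun setT (Radon_Nikodym_SigmaFinite.f nu mu).
  exact: measurable_int (Radon_Nikodym_SigmaFinite.f_integrable numu).
have ge0 (h : T -> \bar R) : measurable_fun setT h -> (forall x, 0 <= h x)%E ->
    (\int[nu]_x h x = \int[mu]_x (h x * (g x)%:E))%E.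
  move=> mh h0; rewrite -(Radon_Nikodym_SigmaFinite.change_of_variables numu)//.
  apply: ae_eq_integral => //; [exact: emeasurable_funM..|].
  exact: ae_eqe_mul2l.
rewrite integralE [RHS]integralE !ge0//; last 2 first.
- exact: measurable_funeneg.
- exact: measurable_funepos.
congr (_ - _)%E; apply: eq_integral => x _.
  by rewrite !funeposE maxe_pMl ?lee_fin// mul0e.
by rewrite !funenegE -mulNe maxe_pMl ?lee_fin// mul0e.
Qed.

Lemma integrable_density (f : T -> \bar R) : measurable_fun setT f ->
  mu.-integrable setT (fun x => f x * (g x)%:E)%E -> nu.-integrable setT f.
Proof.
move=> mf /integrableP[_ fg]; apply/integrableP; split => //.
rewrite integral_density; last exact: measurableT_comp.
under eq_integral => x _ do rewrite -[(g x)%:E]gee0_abs ?lee_fin// -abseM.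
exact: fg.
Qed.

End integral_density.

Section sample_mean_slln.
Context {R : realType} {d : nat} (D : set (euclid R d)) (g : D -> R).
Context {dO : measure_display} {Omega : measurableType dO}
  (P : probability Omega R) (X : nat -> Omega -> D).
Hypotheses (mD : measurable D) (hg : is_pos_density g) (hX : iid_from P X g).

Let valL0E (h : D -> R) (x : D) : 'valL_0 h (val x) = h x.
Proof.
have xD : val x \in D := valP x.
by rewrite /= oinv_set_val insubT//=; congr h; exact: val_inj.
Qed.

Let valL0_out (h : D -> R) y : ~ D y -> 'valL_0 h y = 0.
Proof.
by move=> nDy; rewrite /= oinv_set_val insubN//; apply/negP; rewrite inE.
Qed.

Lemma measurable_valL0 (h : D -> R) :
  measurable_fun D ('valL_0 h) -> measurable_fun setT ('valL_0 h).
Proof.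
move=> mh; rewrite (_ : 'valL_0 h = 'valL_0 h \_ D).
  exact/(measurable_restrictT _ mD).
apply/funext => y; rewrite patchE; case: ifPn => //.
by rewrite notin_setE => /valL0_out.
Qed.

(** Integrability gives measurability of the product [h * g] only; dividing by the positive [g]
    recovers [h]. *)
Lemma density_integrable_measurable (h : D -> R) :
  density_integrable g h -> measurable_fun setT ('valL_0 h).
Proof.
move=> /measurable_int/measurable_EFinP mhg.
have [mg g0 _] := hg.
apply: measurable_valL0.
apply: (@eq_measurable_fun _ _ _ _ _
    (fun y => 'valL_0 (fun x => h x * g x) y * ('valL_0 g y `^ (-1)))).
  move=> y; rewrite inE => Dy.
  rewrite -[y]/(val (SigSub (mem_set Dy))) !valL0E powR_inv1 ?(ltW (g0 _))//.
  by rewrite mulfK// gt_eqF.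
apply: measurable_funM => //.
by apply: (measurableT_comp (measurable_powR _)).
Qed.

(** The law of [X 0] has the zero extension of [g] as Lebesgue density on the whole space, which
    turns integrability and mean of [h (X 0)] into integrals over [D]. *)
Theorem sample_mean_slln (h : D -> R) : density_integrable g h ->
  {ae P, forall w, sample_mean n (X^~ w) h @[n --> \oo] -->
    density_expectation g h}.
Proof.
move=> hint; have [mX densX indX] := hX; have [mg g0 g1] := hg.
have mh := density_integrable_measurable hint.
have mgT : measurable_fun setT ('valL_0 g) by exact: measurable_valL0.
pose Y i : {mfun Omega >-> euclid R d} := mfun_Sub (mem_set (mX i)).
have mZ i : measurable_fun setT ('valL_0 h \o Y i).
  exact: measurableT_comp.
pose Z i : {mfun Omega >-> R} := mfun_Sub (mem_set (mZ i)).
have mpre A : measurable A -> measurable ('valL_0 h @^-1` A).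
  by move=> mA; rewrite -[X in measurable X]setTI; exact: mh.
have Z_indep i j : i != j -> forall A B : set R, measurable A -> measurable B ->
    (P (Z i @^-1` A `&` Z j @^-1` B) = P (Z i @^-1` A) * P (Z j @^-1` B))%E.
  move=> ij A B mA mB.
  (* Mutual independence takes one set per index: the preimage of [A] at [i], that of [B]
     elsewhere. *)
  pose C k := if k == i then 'valL_0 h @^-1` A else 'valL_0 h @^-1` B.
  have := indX [:: i; j] C; rewrite /= inE ij => /(_ isT) indC.
  have mC k : measurable (C k) by rewrite /C; case: ifP => _; exact: mpre.
  have CE : \bigcap_(k in [set` [:: i; j]]) [set w | C k (val (X k w))] =
      Z i @^-1` A `&` Z j @^-1` B.
    apply/seteqP; split => w.
      move=> Cw; split; have := Cw _ _; rewrite /C.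
        by move=> /(_ i); rewrite /= !inE !eqxx => /(_ isT).
      move=> /(_ j); rewrite /= !inE eq_sym (negbTE ij) eqxx orbT.
      by move=> /(_ isT).
    move=> [Zi Zj] k; rewrite /= !inE /C => /orP[/eqP->|/eqP->].
      by rewrite eqxx.
    by rewrite eq_sym (negbTE ij).
  have := indC mC; rewrite CE => ->.
  by rewrite big_cons big_seq1 /C eqxx eq_sym (negbTE ij).
have Z_ident i (A : set R) : measurable A ->
    P (Z i @^-1` A) = P (Z 0%N @^-1` A).
  move=> mA.
  by rewrite [LHS](densX i _ (mpre _ mA)) [RHS](densX 0%N _ (mpre _ mA)).
have nuE (B : set (euclid R d)) : measurable B -> distribution P (Y 0%N) B =
    (\int[@lebesgue_euclid R d]_(x in B) ('valL_0 g x)%:E)%E.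
  move=> mB; rewrite [LHS](densX 0%N _ mB).
  rewrite integral_mkcondr; apply: eq_integral => y _.
  rewrite patchE; case: ifPn => // /negP; rewrite inE => nDy.
  by rewrite valL0_out.
have g0T y : 0 <= 'valL_0 g y.
  have [Dy|nDy] := pselect (D y); last by rewrite valL0_out.
  by rewrite -[y]/(val (SigSub (mem_set Dy))) valL0E ltW.
have mhE : measurable_fun setT (EFin \o 'valL_0 h) by exact/measurable_EFinP.
have hgE y : ('valL_0 (fun x => h x * g x) y)%:E =
    (('valL_0 h y)%:E * ('valL_0 g y)%:E)%E.
  rewrite -EFinM; have [Dy|nDy] := pselect (D y).
    by rewrite -[y]/(val (SigSub (mem_set Dy))) !valL0E.
  by rewrite !valL0_out// mulr0.
have out y : ~ D y -> (('valL_0 h y)%:E * ('valL_0 g y)%:E = 0)%E.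
  by move=> nDy; rewrite -EFinM !valL0_out// mulr0.
have hgD : (fun y => ('valL_0 h y)%:E * ('valL_0 g y)%:E)%E =
    (fun y => ('valL_0 (fun x => h x * g x) y)%:E) \_ D.
  apply/funext => y; rewrite patchE; case: ifPn => // /negP; rewrite inE => nDy.
  by rewrite out.
have intY : (distribution P (Y 0%N)).-integrable setT (EFin \o 'valL_0 h).
  apply: (integrable_density mgT g0T nuE mhE).
  by rewrite hgD -integrable_mkcond.
have intZ : P.-integrable setT (EFin \o Z 0%N).
  apply/integrableP; split; first exact/measurable_EFinP.
  have /integrableP[_] := intY.
  by rewrite ge0_integral_distribution//; exact: measurableT_comp.
have meanZ : \int[P]_w Z 0%N w = density_expectation g h.
  rewrite /density_expectation /Rintegral; congr fine.
  rewrite -(integral_distribution (X := Y 0%N) mhE intZ).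
  rewrite (integral_density mgT g0T nuE mhE).
  rewrite [RHS]integral_mkcond -hgD//.
have := strong_law_of_large_numbers Z_indep Z_ident intZ.
rewrite meanZ; apply: filterS => w.
apply: cvg_trans; apply: near_eq_cvg; apply: nearW => n.
rewrite /sample_mean [RHS]mulrC; congr (_ / _).
by apply: eq_bigr => i _; exact: valL0E.
Qed.

Lemma measurable_sample_mean (h : D -> R) (n : nat) : density_integrable g h ->
  measurable_fun setT (fun w => sample_mean n (X^~ w) h).
Proof.
move=> /density_integrable_measurable mh; have [mX _ _] := hX.
apply: measurable_funM => //; apply: measurable_sum => i.
rewrite (_ : (fun w => _) = 'valL_0 h \o (fun w => val (X i w))).
  by apply: measurableT_comp => //; exact: mX.
by apply/funext => w; rewrite -[LHS]valL0E.
Qed.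

Lemma density_expectation_affine (h1 h2 : D -> R) (t : R) :
  density_integrable g h1 -> density_integrable g h2 ->
  density_expectation g (fun y => t * h1 y + (1 - t) * h2 y) =
  t * density_expectation g h1 + (1 - t) * density_expectation g h2.
Proof.
move=> i1 i2; rewrite /density_expectation.
transitivity (\int[@lebesgue_euclid R d]_(y in D)
    (t * 'valL_0 (fun x => h1 x * g x) y +
     (1 - t) * 'valL_0 (fun x => h2 x * g x) y)).
  apply: eq_Rintegral => y; rewrite inE => Dy.
  rewrite -[y]/(val (SigSub (mem_set Dy))) !valL0E; ring.
have iZ c h : density_integrable g h -> (@lebesgue_euclid R d).-integrable D
    (EFin \o (fun y => c * 'valL_0 (fun x => h x * g x) y)).
  move=> ih; have := integrableZl mD c ih; exact: eq_integrable.
by rewrite RintegralD ?RintegralZl//; exact: iZ.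
Qed.

End sample_mean_slln.

(** * Strong duality with inner probability one *)

Section eventually.
Context {dO : measure_display} {Omega : measurableType dO} {R : realType}
  (P : probability Omega R).

Lemma inner_probability_le1 (B : set Omega) : (inner_probability P B <= 1)%E.
Proof. by apply: ge_ereal_sup => _ [A [mA _] <-]; exact: probability_le1. Qed.

Lemma inner_probability_ge (A B : set Omega) :
  measurable A -> A `<=` B -> (P A <= inner_probability P B)%E.
Proof. by move=> mA AB; apply: ereal_sup_ubound; exists A. Qed.

(** Inner probabilities are bounded below through measurable subsets. The [G n] will play this part
    for the strong duality events, and their monotonicity gives [P (G n)] tending to one. *)
Lemma eventually_within (I : finType) (Y : I -> nat -> Omega -> R)
    (e eps : I -> R) :
  (forall i n, measurable_fun setT (Y i n)) -> (forall i, 0 < eps i) ->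
  (forall i, {ae P, forall w, Y i n w @[n --> \oo] --> e i}) ->
  exists G : nat -> set Omega, [/\ forall n, measurable (G n),
    nondecreasing_seq G, P (\bigcup_n G n) = 1%E &
    forall n w, G n w -> forall k, (n <= k)%N ->
      forall i, `|Y i k w - e i| < eps i].
Proof.
move=> mY eps0 aeY.
pose good k := \bigcap_(i in [set: I]) [set w | `|Y i k w - e i| < eps i].
have mgood k : measurable (good k).
  apply: fin_bigcap_measurable => [|i _]; first exact: finite_finset.
  rewrite -[X in measurable X]setTI.
  rewrite (_ : [set w | _] =
    (fun w => `|Y i k w - e i| < eps i) @^-1` [set true]) //.
  apply: measurable_fun_ltr => //; apply: measurableT_comp => //.
  exact: measurable_funB.
pose G n := \bigcap_(k in [set k | (n <= k)%N]) good k.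
have mG n : measurable (G n).
  by apply: bigcap_measurable => [|k _]; [exists n => /=|exact: mgood].
exists G; split => //.
- move=> n n' nn'; apply/subsetPset => w Gw k /= n'k; apply: Gw => /=.
  exact: leq_trans n'k.
- have mU : measurable (\bigcup_n G n) by exact: bigcupT_measurable.
  suff : P (~` \bigcup_n G n) = 0%E.
    move=> PC; rewrite -[\bigcup_n G n]setCK probability_setC ?PC ?sube0//.
    exact: measurableC.
  apply/negligibleP; first exact: measurableC.
  have : {ae P, forall w, forall i, Y i n w @[n --> \oo] --> e i}.
    by apply: filter_forall => i; exact: aeY.
  apply: negligibleS => w nUw Yw; apply: nUw.
  have : \forall k \near \oo, forall i, `|Y i k w - e i| < eps i.
    apply: filter_forall => i; have /cvgrPdist_lt/(_ _ (eps0 i)) := Yw i.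
    by apply: filterS => k; rewrite distrC.
  by move=> [n _ nP]; exists n => // k nk i _; exact: nP.
- by move=> n w Gw k nk i; exact: (Gw k nk i).
Qed.

End eventually.

(** * Convex combinations and Slater witnesses *)

Lemma convex_set_lerp (R : realType) (T : Type) (A : set (T -> R)) :
  convex_set (A : set (convex_lmodType (T -> R^o))) ->
  forall f f' t, A f -> A f' -> 0 < t < 1 ->
    A (fun y => t * f y + (1 - t) * f' y).
Proof.
move=> /convex_setW cvx f f' t Af Af' /andP[t0 t1].
have := cvx f f' (mem_set Af) (mem_set Af') (Itv01 (ltW t0) (ltW t1)) t0 t1.
by rewrite inE.
Qed.

(** A short enough step from [b] towards [a] preserves finitely many strict inequalities. *)
Lemma small_lerp_lt (R : realType) (m : nat) (a b c : nat -> R) :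
  (forall j, (1 <= j <= m)%N -> b j < c j) ->
  exists2 t, 0 < t < 1 &
    forall j, (1 <= j <= m)%N -> t * a j + (1 - t) * b j < c j.
Proof.
move=> bc.
have : \forall t \near (0 : R)^'+, forall j : 'I_m.+1, (1 <= j)%N ->
    t * a j + (1 - t) * b j < c j.
  apply: filter_forall => j; case: (leqP 1 j) => j1; last exact: nearW.
  have jm : (1 <= j <= m)%N by rewrite j1 -ltnS ltn_ord.
  near=> t => _.
  have t0 : 0 < t by near: t; exact: nbhs_right_gt.
  have K0 : 0 < `|a j - b j| + 1 by rewrite ltr_wpDl.
  have : t < (c j - b j) / (`|a j - b j| + 1).
    by near: t; apply: nbhs_right_lt; rewrite divr_gt0// subr_gt0 bc.
  rewrite ltr_pdivlMr//; have := ler_wpM2l (ltW t0) (ler_norm (a j - b j)).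
  by move=> *; lra.
move=> tP; near (0 : R)^'+ => t; exists t.
  by apply/andP; split; near: t; [exact: nbhs_right_gt|exact: nbhs_right_lt].
move=> j /andP[j1 jm].
have /(_ (Ordinal (jm : (j < m.+1)%N)) j1) : forall j : 'I_m.+1, (1 <= j)%N ->
    t * a j + (1 - t) * b j < c j by near: t.
by [].
Unshelve. all: by end_near. Qed.

(** The interior ball supplies [L1], displaced in equality coordinate [i] alone but possibly
    violating inequalities. A short step from [L0] towards [L1] keeps the inequalities strict and
    the sign of the displacement. *)
Lemma slater_witnesses (R : realType) (T : Type) (m l : nat)
    (E : nat -> (T -> R) -> R) (mu : nat -> R) (LL : set (T -> R)) (L0 : T -> R) :
  (m <= l)%N ->
  (forall L L' t, LL L -> LL L' -> 0 < t < 1 ->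
    LL (fun y => t * L y + (1 - t) * L' y)) ->
  (forall j L L' t, (j <= l)%N -> LL L -> LL L' ->
    E j (fun y => t * L y + (1 - t) * L' y) = t * E j L + (1 - t) * E j L') ->
  LL L0 -> (forall j, (1 <= j <= m)%N -> E j L0 < mu j) ->
  (forall j, (m < j <= l)%N -> E j L0 = mu j) ->
  interior [set (\row_(i < l - m) E (m + i).+1 L : 'rV[R]_(l - m)) | L in LL]
    (\row_(i < l - m) mu (m + i).+1) ->
  exists V : nat -> bool -> T -> R, forall i s, [/\ LL (V i s),
    forall j, (1 <= j <= m)%N -> E j (V i s) < mu j &
    (m < i <= l)%N -> 0 < (-1) ^+ s * (E i (V i s) - mu i) /\
      forall j, (m < j <= l)%N -> j != i -> E j (V i s) = mu j].
Proof.
move=> ml cvx Eaff LL0 L0lt L0eq /nbhs_ballP[delta /= delta0 ballE].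
suff /choice[V VP] : forall p : nat * bool, exists V, [/\ LL V,
    forall j, (1 <= j <= m)%N -> E j V < mu j &
    (m < p.1 <= l)%N -> 0 < (-1) ^+ p.2 * (E p.1 V - mu p.1) /\
      forall j, (m < j <= l)%N -> j != p.1 -> E j V = mu j].
  by exists (fun i s => V (i, s)) => i s; exact: VP (i, s).
move=> [i s] /=; have [mil|nmil] := boolP (m < i <= l)%N; last first.
  by exists L0; split.
(* Half the radius keeps the displaced point inside the open ball. *)
pose c : R := (-1) ^+ s * (delta / 2).
have [L1 LL1 EL1] : exists2 L1, LL L1 & forall j, (m < j <= l)%N ->
    E j L1 = mu j + c * (j == i)%:R.
  have [|L1 LL1 /rowP EL1] := ballE
      (\row_(k < l - m) (mu (m + k).+1 + c * ((m + k).+1 == i)%:R)).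
    split=> // a k; rewrite !mxE -ball_normE/= opprD addNKr normrN.
    rewrite /c normrM normrM normrX normrN normr1 expr1n mul1r.
    rewrite ger0_norm ?divr_ge0 ?(ltW delta0)//.
    case: eqP => _; rewrite ?normr1 ?normr0 ?mulr1 ?mulr0//.
    by rewrite ltr_pdivrMr// ltr_pMr// ltr1n.
  exists L1 => // j /andP[mj jl].
  (* Row entry [k] belongs to constraint [(m + k).+1], so [j] sits at [j - m.+1]. *)
  have jlm : (j - m.+1 < l - m)%N by rewrite ltn_subLR// addSn subnKC.
  by have := EL1 (Ordinal jlm); rewrite !mxE/= -addSn subnKC.
have [t /[dup] t01 /andP[t0 t1] tP] := small_lerp_lt (fun j => E j L1) L0lt.
have Elerp j : (m < j <= l)%N ->
    E j (fun y => t * L1 y + (1 - t) * L0 y) = mu j + t * (c * (j == i)%:R).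
  by move=> /[dup] mjl /andP[mj jl]; rewrite Eaff// EL1// L0eq//; ring.
exists (fun y => t * L1 y + (1 - t) * L0 y); split; first exact: cvx.
  move=> j /[dup] jm /andP[_ jm']; rewrite Eaff ?tP//.
  exact: leq_trans ml.
move=> _; split=> [|j mjl ji]; rewrite Elerp//; last first.
  by rewrite (negbTE ji) !mulr0 addr0.
rewrite eqxx mulr1 addrC addKr.
have -> : (-1) ^+ s * (t * c) = t * (delta / 2).
  by rewrite /c mulrCA; congr (_ * _); rewrite signrMK.
by rewrite mulr_gt0// divr_gt0.
Qed.

Theorem theorem2 (R : realType) (d : nat) (D : set (euclid R d))
  (m l : nat) (phi : nat -> D -> R) (mu : nat -> R)
  (F : set (D -> R)) (g : D -> R)
  (dO : measure_display) (Omega : measurableType dO) (P : probability Omega R)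
  (X : nat -> Omega -> D)
  (hD : measurable D)
  (hml : (m <= l)%N)
  (hmass : exists2 j, (1 <= j <= l)%N & phi j = (fun _ => 1))
  (hF : forall f, F f -> forall x, 0 <= f x)
  (hg : is_pos_density g)
  (hX : iid_from P X g) :
  let LL := likelihood_ratios F g in
  let valP n x := primal_val m l phi mu LL n x in
  let valD n x := dual_val m l phi mu LL n x in
  let strong n := [set w | valP n (X ^~ w) = valD n (X ^~ w)] in
  let E j L := density_expectation g (fun x => phi j x * L x) in
  (forall (n : nat) (x : nat -> D), (0 < n)%N -> (valP n x <= valD n x)%E)
  /\
  ((forall L, LL L -> forall j, (j <= l)%N ->
      density_integrable g (fun x => phi j x * L x)) ->
   convex_set (LL : set (convex_lmodType (D -> R^o))) ->
   (exists L0, [/\ LL L0,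
      forall j, (1 <= j <= m)%N -> E j L0 < mu j
    & forall j, (m < j <= l)%N -> E j L0 = mu j]) ->
   interior [set (\row_(i < l - m) E (m + i).+1 L : 'rV[R]_(l - m)) | L in LL]
     (\row_(i < l - m) mu (m + i).+1) ->
   [/\ inner_probability P
         (\bigcup_(n in [set n | (0 < n)%N])
            \bigcap_(k in [set k | (n <= k)%N]) strong k) = 1%E,
       inner_probability P
         [set w | exists2 N0, (0 < N0)%N &
            forall n, (N0 <= n)%N -> strong n w] = 1%E
     & inner_probability P (strong n) @[n --> \oo] --> 1%E]).
Proof.
move=> LL valP valD strong E; split=> [n x n0|].
  exact: sample_weak_duality.
move=> hint /convex_set_lerp cvx [L0 [LL0 L0lt L0eq]] hinterior.
have Eaff j L L' t : (j <= l)%N -> LL L -> LL L' ->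
    E j (fun y => t * L y + (1 - t) * L' y) = t * E j L + (1 - t) * E j L'.
  move=> jl LLL LLL'; rewrite -density_expectation_affine//; last 2 first.
  - exact: hint.
  - exact: hint.
  by congr density_expectation; apply/funext => y; ring.
have [V VP] := slater_witnesses hml cvx Eaff LL0 L0lt L0eq hinterior.
have LLV i s : LL (V i s) by have [] := VP i s.
(* A finite index type for all witnesses, with [None] for [L0], so that [eventually_within] controls
   them together. *)
pose W (o : option ('I_l.+1 * bool)) := if o is Some (i, s) then V i s else L0.
have LLW o : LL (W o) by case: o => [[i s]|]; [exact: LLV|].
have Wlt o j : (1 <= j <= m)%N -> E j (W o) < mu j.
  by case: o => [[i s]|]; [have [_ + _] := VP i s; apply|exact: L0lt].
(* With the gap cut into [l.+1] parts, a sample deviation below one part leaves more than [l] parts,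
   as diagonal dominance asks. *)
pose eta i (s : bool) := (-1) ^+ s * (E i (V i s) - mu i) / l.+1%:R.
have eta0 i s : (m < i <= l)%N -> 0 < eta i s.
  by move=> mil; rewrite divr_gt0//; have [_ _ /(_ mil)[]] := VP i s.
(* how far the sample means may deviate from the expectations without
   spoiling the witnesses *)
pose eps (k : option ('I_l.+1 * bool) * 'I_l.+1) : R :=
  if (1 <= k.2 <= m)%N then mu k.2 - E k.2 (W k.1)
  else if k.1 is Some (i, s) then (if (m < i)%N then eta i s else 1) else 1.
have eps0 k : 0 < eps k.
  rewrite /eps; case: ifPn => [jm|_]; first by rewrite subr_gt0 Wlt.
  case: k => -[[i s]|] j //=; case: ifPn => // mi; apply: eta0.
  by rewrite mi -ltnS ltn_ord.
pose Y (k : option ('I_l.+1 * bool) * 'I_l.+1) n w :=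
  sample_mean n (X ^~ w) (fun y => phi k.2 y * W k.1 y).
have intY (k : option ('I_l.+1 * bool) * 'I_l.+1) :
    density_integrable g (fun y => phi k.2 y * W k.1 y).
  by apply: hint; [exact: LLW|rewrite -ltnS].
have [G [mG ndG PG GP]] := @eventually_within _ _ _ P _ Y
  (fun k => E k.2 (W k.1)) eps
  (fun k n => measurable_sample_mean hD hg hX n (intY k)) eps0
  (fun k => sample_mean_slln hD hg hX (intY k)).
have Gstrong n k w : G n w -> (n <= k)%N -> (0 < k)%N -> strong k w.
  move=> Gw nk k0.
  have near_mean o j (jl : (j < l.+1)%N) :
      `|sample_mean k (X ^~ w) (fun y => phi j y * W o y) - E j (W o)| <
      eps (o, Ordinal jl).
    exact: (GP n w Gw k nk (o, Ordinal jl)).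
  have neg o j : (1 <= j <= m)%N -> excess phi mu k (X ^~ w) j (W o) < 0.
    move=> /[dup] jm /andP[j1 jm']; have jl : (j <= l)%N := leq_trans jm' hml.
    have := near_mean o j jl; rewrite /eps /= jm /excess gtn_eqF//.
    by move=> /ltr_normlW; rewrite ltrBrDr subrK subr_lt0.
  apply: (@sample_strong_duality _ _ _ _ _ _ _ _ _ hml k0 L0 V eta) => //.
  - by move=> j; exact: (neg None).
  - move=> i s /[dup] mil /andP[mi il].
    have il' : (i < l.+1)%N by [].
    have [_ _ /(_ mil)[_ Veq]] := VP i s.
    have dev j : (m < j <= l)%N ->
        `|excess phi mu k (X ^~ w) j (V i s) - (E j (V i s) - mu j)| < eta i s.
      move=> /andP[mj jl]; have := near_mean (Some (Ordinal il', s)) j jl.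
      rewrite /eps /= [(j <= m)%N]leqNgt mj andbF mi /excess gtn_eqF ?(leq_ltn_trans _ mj)//.
      by rewrite opprB addrA subrK.
    split.
    + exact/ltW/eta0.
    + have gapE : (-1) ^+ s * (E i (V i s) - mu i) = l.+1%:R * eta i s.
        by rewrite /eta [RHS]mulrC divfK.
      have : `|(-1) ^+ s * excess phi mu k (X ^~ w) i (V i s) -
          l.+1%:R * eta i s| < eta i s.
        by rewrite -gapE -mulrBr normrM normrX normrN1 expr1n mul1r dev.
      by rewrite ltr_distl -natr1 mulrDl mul1r addrK => /andP[].
    + by move=> j; exact: (neg (Some (Ordinal il', s))).
    + by move=> j mjl ji; have := dev j mjl; rewrite Veq// subrr subr0 => /ltW.
have mU : measurable (\bigcup_n G n) by exact: bigcupT_measurable.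
have inner1 (B : set Omega) : \bigcup_n G n `<=` B -> inner_probability P B = 1%E.
  move=> GB; apply/eqP; rewrite eq_le inner_probability_le1/=.
  by rewrite -PG inner_probability_ge.
split.
(* Starting at [n.+1] keeps the sample sizes positive. *)
- apply: inner1 => w [n _ Gw]; exists n.+1 => // k /= nk.
  by apply: (Gstrong n) => //; [exact: ltnW|exact: leq_ltn_trans nk].
- apply: inner1 => w [n _ Gw]; exists n.+1 => // k nk.
  by apply: (Gstrong n) => //; [exact: ltnW|exact: leq_ltn_trans nk].
(* [P (G n)] tends to one by continuity from below, and bounds the inner probability from below once
   [n] is positive. *)
- apply: (@squeeze_cvge _ _ _ _ (P \o G) _ (cst 1%E)).
  + exists 1%N => // n /= n0; rewrite inner_probability_le1 andbT.
    apply: inner_probability_ge => // w Gw; exact: (Gstrong n).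
  + by rewrite -PG; exact: nondecreasing_cvg_mu.
  + exact: cvg_cst.
Qed.
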